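(* Fix $n\ge4$. Let $K\subset S^n$ be a nondegenerate continuum with $\dim_{\mathcal H}K=1$, let $M:=S^n\setminus K$, and let $\phi:M\to(0,\infty)$ be a smooth function with $m_0:=\inf_M\phi>0$, such that $M$ is a contractible smooth open manifold that is not simply connected at infinity, and such that for every $t\in(-m_0,\infty)$ the metric $g^{(t)}:=(\phi+t)^{4/(n-2)}g_{st}|_M$ is smooth, complete and locally conformally flat with $\mathrm{Sc}_{g^{(t)}}=n(n-1)t(\phi+t)^{-(n+2)/(n-2)}$. Then the manifold $M$ is connected, smooth, open, and simply connected, and $\widetilde H_i(M;\mathbb Z)=0$ for all $i\ge0$. For every $t\ge0$, the metric $g^{(t)}$ is complete and locally conformally flat with $\mathrm{Sc}_{g^{(t)}}\ge0$. Moreover, the inclusion $\iota:M\hookrightarrow S^n$ may be chosen as a developing map of $(M,g^{(t)})$, and the omitted set, and also the topological boundary of the developing image, is $\Lambda:=S^n\setminus\iota(M)=\partial\iota(M)=K$, which is a nondegenerate continuum. Nevertheless, $M$ is not homeomorphic to $\mathbb R^n$. Consequently, for every $n\ge4$: \begin{enumerate} \item[(a)] there is a complete, open, simply connected, locally conformally flat $n$-manifold with nonnegative scalar curvature that is not homeomorphic to $\mathbb R^n$ (so the implication ``complete, open, simply connected, locally conformally flat, $\mathrm{Sc}\ge0$, $\lfloor\frac{n-2}{2}\rfloor$-connected at infinity, and $\Lambda$ satisfies the small loops condition in $S^n$ $\Rightarrow$ $M\cong\mathbb R^n$'' can fail when the last two topological hypotheses are omitted simultaneously); \item[(b)] there is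 a connected, open, simply connected $n$-manifold $M$ with $\widetilde H_{n-1}(M;\mathbb Z)=0$ carrying a complete locally conformally flat metric $g$ with $\mathrm{Sc}_g\ge0$ that is not homeomorphic to $\mathbb R^n$ (so, in the theorem asserting that such an $(M,g)$ is conformally diffeomorphic to Euclidean space if at least one of the conditions (i)--(v) listed in the context holds, this disjunction of conditions cannot be omitted, even if the conclusion is weakened from conformal equivalence to homeomorphism). \end{enumerate}
   Context: A theorem of the paper asserts that data $(K,\phi)$ as in the first paragraph exist for every $n\ge4$. Here $g_{st}$ is the round metric of curvature $1$ on $S^n$; a continuum is a nonempty compact connected metric space, nondegenerate if it has more than one point; $\dim_{\mathcal H}$ is Hausdorff dimension; open means noncompact without boundary. A manifold $X$ is simply connected at infinity if it is one-ended and for every compact $C\subset X$ there is a compact $D\supset C$ in $X$ such that every loop in $X\setminus D$ is null-homotopic in $X\setminus C$. A metric is locally conformally flat if every point has a neighborhood conformally diffeomorphic to an open subset of $(S^n,g_{st})$; for simply connected $M$ a developing map is a conformal local diffeomorphism $\Phi:M\to S^n$, and $\Lambda=S^n\setminus\Phi(M)$. $d$-connected at infinity ($d\ge1$): one-ended and for every compact $C$ there is a compact $K'\supset C$ such that every map $S^q\to M\setminus K'$ extends to $B^{q+1}\to M\setminus C$ for all $1\le q\le d$. Small loops condition for compact $X\subset S^n$: for every neighborhood $U$ of $X$ there exist a neighborhood $V\subset U$ of $X$ and $\varepsilon>0$ such that every loop in $V\setminus X$ of diameter $<\varepsilon$ is null-homotopic in $U\setminus X$. Conditions (i)--(v) referred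 to in (b): (i) $\mathrm{Ric}_g\ge0$ outside a compact set; (ii) $\mathrm{Ric}_g^-\in L^1\cap L^\infty$, $\mathrm{Sc}_g\in L^\infty$, $|\nabla\mathrm{Sc}_g|\in L^\infty$, where $\mathrm{Ric}^-_g=\max\{0,-\lambda_{\min}(g^{-1}\mathrm{Ric}_g)\}$; (iii) $|\mathrm{Ric}_g|\in L^{n/2}$; (iv) $\lim_{r\to\infty}\mathrm{Vol}_g(B_p(r))/(r^n(\log r)^{n-1})=0$ for some $p\in M$; (v) $(p_0-2)\mathrm{Ric}_g+\frac{n-p_0}{2(n-1)}\mathrm{Sc}_g\,g\ge0$ for some $p_0\in(n-2,n)$. *)

(* Defs.v *)
From mathcomp Require Import all_boot all_order all_algebra.
From mathcomp Require Import all_classical all_reals all_analysis.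
From mathcomp.multinomials Require Import freeg.

Set Implicit Arguments.
Unset Strict Implicit.
Unset Printing Implicit Defensive.

Import Order.TTheory GRing.Theory Num.Theory.
Import numFieldNormedType.Exports.

Local Open Scope classical_set_scope.
Local Open Scope ring_scope.

Definition homeomorphic (X Y : topologicalType) : Prop :=
  exists (f : X -> Y) (f' : Y -> X),
    [/\ continuous f, continuous f', cancel f f' & cancel f' f].

Definition boundary (X : topologicalType) (A : set X) : set X :=
  closure A `\` A°.

Section Homotopy.
Variables (R : realType) (X : topologicalType).

Local Notation I := (`[0, 1]%classic : set R).

Definition is_path (c : R -> X) : Prop := {within I, continuous c}.

Definition is_loop (c : R -> X) : Prop := is_path c /\ c 0 = c 1.

(* The null-homotopy is relative to the base point and stays in A. *)
Definition null_homotopic_in (A : set X) (c : R -> X) : Prop :=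
  exists H : R * R -> X,
    [/\ {within I `*` I, continuous H},
        forall s t, I s -> I t -> A (H (s, t)),
        forall s, I s -> H (s, 0) = c s /\ H (s, 1) = c 0 &
        forall t, I t -> H (0, t) = c 0 /\ H (1, t) = c 0].

Definition path_connected : Prop :=
  forall x y : X, exists c : R -> X, [/\ is_path c, c 0 = x & c 1 = y].

Definition simply_connected : Prop :=
  path_connected /\
  forall c : R -> X, is_loop c -> null_homotopic_in setT c.

Definition contractible : Prop :=
  exists (x0 : X) (H : X * R -> X),
    [/\ {within setT `*` I, continuous H},
        forall x, H (x, 0) = x & forall x, H (x, 1) = x0].

(* A (Freudenthal) end chooses a component of the complement of each compact
   set, compatibly with inclusions; its values on other sets are junk. *)
Definition is_end (e : set X -> set X) : Prop :=
  (forall C, compact C ->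
     exists2 x, ~ C x & e C = connected_component (~` C) x) /\
  (forall C D, compact C -> compact D -> C `<=` D -> e D `<=` e C).

Definition one_ended : Prop :=
  exists2 e, is_end e &
    forall e', is_end e' -> forall C, compact C -> e' C = e C.

Definition simply_connected_at_infinity : Prop :=
  one_ended /\
  forall C : set X, compact C ->
    exists D : set X, [/\ compact D, C `<=` D &
      forall c : R -> X, is_loop c -> (forall s, I s -> ~ D (c s)) ->
        null_homotopic_in (~` C) c].

Definition nondegenerate_continuum (K : set X) : Prop :=
  [/\ K !=set0, compact K, connected K & exists x y, [/\ K x, K y & x <> y]].

End Homotopy.

Section Homology.
Variable R : realType.

Definition std_simplex (k : nat) : set 'rV[R]_k.+1 :=
  [set x | (forall i, 0 <= x 0 i) /\ \sum_i x 0 i = 1].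

Arguments std_simplex k : clear implicits.

Definition face_row (k : nat) (j : 'I_k.+2) (x : 'rV[R]_k.+1) : 'rV[R]_k.+2 :=
  \row_i (if unlift j i is Some i' then x 0 i' else 0).

Lemma face_row_simplex k (j : 'I_k.+2) (x : std_simplex k) :
  face_row j (set_val x) \in std_simplex k.+1.
Proof.
have [x0 x1] := set_valP x; apply/mem_set; split=> [i|].
  by rewrite mxE; case: unliftP => // i' _; exact: x0.
rewrite (bigD1_ord j) //= mxE unlift_none add0r -[RHS]x1.
by apply: eq_bigr => i _; rewrite mxE liftK.
Qed.

Definition face (k : nat) (j : 'I_k.+2) (x : std_simplex k) :
  std_simplex k.+1 := exist _ (face_row j (set_val x)) (face_row_simplex j x).

Lemma face_row_continuous k (j : 'I_k.+2) : continuous (@face_row k j).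
Proof.
move=> x A /nbhs_ballP[e e0 eA]; apply/nbhs_ballP; exists e => // y [_ xy].
apply: eA; split=> // i i'; rewrite !mxE.
by case: unliftP => [k' _|_]; [exact: xy|exact: ballxx].
Qed.

Lemma face_continuous k (j : 'I_k.+2) : continuous (@face k j).
Proof.
apply: (@continuous_comp_initial _ _ _ set_val) => x.
apply: (@continuous_comp _ _ _ set_val (face_row j)).
  exact: initial_continuous.
exact: face_row_continuous.
Qed.

Variable X : topologicalType.

Definition singular_simplex (k : nat) : Type :=
  {s : std_simplex k -> X | continuous s}.

Lemma singular_face_continuous k (j : 'I_k.+2) (s : singular_simplex k.+1) :
  continuous (sval s \o face j).
Proof.
have s_cont : continuous (sval s) := proj2_sig s.
move=> x; apply: (@continuous_comp _ _ _ (face j) (sval s)).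
  exact: face_continuous.
exact: s_cont.
Qed.

Definition singular_face k (j : 'I_k.+2) (s : singular_simplex k.+1) :
  singular_simplex k := exist _ _ (@singular_face_continuous k j s).

Definition chain (k : nat) := {freeg {classic (singular_simplex k)} / int}.

Definition singular_boundary k : chain k.+1 -> chain k :=
  fglift (fun s : {classic (singular_simplex k.+1)} =>
    \sum_(j < k.+2)
      << (-1) ^+ j *g (singular_face j s : {classic (singular_simplex k)}) >>).

(* Vanishing of H~_k(X; Z); the augmentation C_0(X) -> Z is deg. *)
Definition reduced_homology_trivial (k : nat) : Prop :=
  match k with
  | 0%N => forall c : chain 0, deg c = 0 ->
             exists d : chain 1, singular_boundary d = c
  | k'.+1 => forall c : chain k'.+1, singular_boundary c = 0 ->
             exists d : chain k'.+2, singular_boundary d = c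
  end.

End Homology.

Section HausdorffDimension.
Variables (R : realType) (m : nat).

(* The library norm on row vectors is the sup norm. *)
Definition euclidean_dist (x y : 'rV[R]_m) : R :=
  Num.sqrt (\sum_i (x 0 i - y 0 i) ^+ 2).

Definition diameter (A : set 'rV[R]_m) : \bar R :=
  ereal_sup (0%E |` [set (euclidean_dist x y)%:E | x in A & y in A]).

Definition hausdorff_premeasure (s delta : R) (A : set 'rV[R]_m) : \bar R :=
  ereal_inf [set (\sum_(0 <= i <oo) (diameter (U i) `^ s))%E |
    U in [set U : nat -> set 'rV[R]_m |
      A `<=` \bigcup_i U i /\ forall i, (diameter (U i) <= delta%:E)%E]].

Definition hausdorff_measure (s : R) (A : set 'rV[R]_m) : \bar R :=
  ereal_sup [set hausdorff_premeasure s delta A | delta in [set d | 0 < d]].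

Definition hausdorff_dim (A : set 'rV[R]_m) : \bar R :=
  ereal_inf [set s%:E | s in [set s | 0 < s /\ hausdorff_measure s A = 0%E]].

End HausdorffDimension.

Section Smooth.
Variables (R : realType) (m : nat) (V : normedModType R).

Definition partial (i : 'I_m) (f : 'rV[R]_m -> V) : 'rV[R]_m -> V :=
  'D_(delta_mx 0 i) f.

Fixpoint Ck_on (k : nat) (U : set 'rV[R]_m) (f : 'rV[R]_m -> V) : Prop :=
  match k with
  | 0%N => forall x, U x -> {for x, continuous f}
  | k'.+1 => (forall x, U x -> differentiable f x) /\
             forall i, Ck_on k' U (partial i f)
  end.

Definition smooth_on (U : set 'rV[R]_m) (f : 'rV[R]_m -> V) : Prop :=
  forall k, Ck_on k U f.

End Smooth.

Record charted (R : realType) (n : nat) := Charted {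
  carrier :> topologicalType;
  index : Type;
  chart_dom : index -> set carrier;
  chart : index -> carrier -> 'rV[R]_n }.

Section Manifold.
Variables (R : realType) (n : nat) (X : charted R n).
Implicit Types (i j : index X).

Definition chart_im i : set 'rV[R]_n := chart i @` chart_dom i.

(* The expression f \o (chart i)^-1, extended by 0 outside chart_im i. *)
Definition local_expr (V : zmodType) i (f : X -> V) (y : 'rV[R]_n) : V :=
  match pselect (exists x, chart_dom i x /\ chart i x = y) with
  | left h => f (sval (cid h))
  | right _ => 0
  end.

(* A homeomorphism from an open subset of X onto an open subset of R^n. *)
Definition is_chart i : Prop :=
  [/\ open (chart_dom i),
      forall x x', chart_dom i x -> chart_dom i x' ->
        chart i x = chart i x' -> x = x',
      forall x, chart_dom i x -> {for x, continuous (chart i)} &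
      forall U, open U -> U `<=` chart_dom i -> open (chart i @` U)].

Definition smooth_manifold : Prop :=
  [/\ hausdorff_space X, @second_countable X,
      forall x : X, exists i, chart_dom i x,
      forall i, is_chart i &
      forall i j, smooth_on (chart i @` (chart_dom i `&` chart_dom j))
                            (local_expr i (chart j))].

(* Charts take values in R^n, so there is no boundary. *)
Definition open_manifold : Prop := smooth_manifold /\ ~ compact [set: X].

Definition smooth_fun (f : X -> R) : Prop :=
  forall i, smooth_on (chart_im i) (local_expr i f).

End Manifold.

Definition open_submanifold (R : realType) (n : nat) (X : charted R n)
    (U : set X) : charted R n :=
  @Charted R n (set_type U) (index X)
    (fun i => set_val @^-1` chart_dom i) (fun i => chart i \o set_val).

Definition smooth_map_on (R : realType) (n : nat) (X Y : charted R n)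
    (U : set X) (f : X -> Y) : Prop :=
  (forall x, U x -> {for x, continuous f}) /\
  forall (i : index X) (j : index Y),
    smooth_on (chart i @` (U `&` chart_dom i `&` f @^-1` chart_dom j))
              (local_expr i (chart j \o f)).

(* A diffeomorphism from U onto the open set f @` U. *)
Definition diffeo_on (R : realType) (n : nat) (X Y : charted R n)
    (U : set X) (f : X -> Y) : Prop :=
  [/\ smooth_map_on U f, open (f @` U) &
      exists f' : Y -> X,
        smooth_map_on (f @` U) f' /\ forall x, U x -> f' (f x) = x].

Definition local_diffeo (R : realType) (n : nat) (X Y : charted R n)
    (f : X -> Y) : Prop :=
  forall x, exists U, [/\ open U, U x & diffeo_on U f].

(* The matrix g i y is the Gram matrix of the coordinate frame of the chart i
   at the point with coordinates y. *)
Definition metric_data (R : realType) (n : nat) (X : charted R n) : Type :=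
  index X -> 'rV[R]_n -> 'M[R]_n.

(* The jacobian acts on row vectors from the right, hence J *m h *m J^T. *)
Definition pullback (R : realType) (n : nat) (X Y : charted R n)
    (h : metric_data Y) (f : X -> Y) (i : index X) (j : index Y) (x : X) :
    'M[R]_n :=
  let J := jacobian (local_expr i (chart j \o f)) (chart i x) in
  J *m h j (chart j (f x)) *m J^T.

Section Metric.
Variables (R : realType) (n : nat) (X : charted R n).
Implicit Types (i j : index X) (g : metric_data X).

Definition riemannian_metric g : Prop :=
  [/\ forall i, smooth_on (chart_im i) (g i),
      forall i y, chart_im i y -> (g i y)^T = g i y,
      forall i y (v : 'rV[R]_n), chart_im i y -> v != 0 ->
        0 < (v *m g i y *m v^T) 0 0 &
      forall i j x, chart_dom i x -> chart_dom j x ->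
        g i (chart i x) = pullback g id i j x].

(* A C^1 curve of length l from x to y, contained in one chart domain. *)
Definition segment g (x y : X) (l : R) : Prop :=
  exists i (c : R -> 'rV[R]_n),
    [/\ (forall t, t \in `[0, 1] -> derivable c t 1) /\
          {within `[0, 1], continuous (derive1 c)},
        forall t, t \in `[0, 1] -> chart_im i (c t),
        chart_dom i x /\ chart i x = c 0,
        chart_dom i y /\ chart i y = c 1 &
        l = Rintegral (@lebesgue_measure R) `[0, 1]
              (fun t => Num.sqrt ((derive1 c t *m g i (c t) *m (derive1 c t)^T) 0 0))].

(* Finite concatenations of such segments are the piecewise C^1 curves. *)
Inductive joined g (x : X) : X -> R -> Prop :=
| joined_nil : joined g x x 0
| joined_cons y z l l' :
    joined g x y l -> segment g y z l' -> joined g x z (l + l').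

Definition riemannian_dist g (x y : X) : \bar R :=
  ereal_inf [set l%:E | l in joined g x y].

Definition complete_metric g : Prop :=
  forall u : nat -> X,
    (forall e : R, 0 < e -> exists N, forall p q, (N <= p)%N -> (N <= q)%N ->
       (riemannian_dist g (u p) (u q) < e%:E)%E) ->
    exists x, forall e : R, 0 < e -> exists N, forall p, (N <= p)%N ->
       (riemannian_dist g (u p) x < e%:E)%E.

End Metric.

Section Curvature.
Variables (R : realType) (n : nat).
Variable G : 'rV[R]_n -> 'M[R]_n.

Definition christoffel (k i j : 'I_n) (y : 'rV[R]_n) : R :=
  2^-1 * \sum_l invmx (G y) k l *
    (partial i (fun z => G z j l) y + partial j (fun z => G z i l) y
     - partial l (fun z => G z i j) y).

Definition ricci (i j : 'I_n) (y : 'rV[R]_n) : R :=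
  \sum_k (partial k (christoffel k i j) y - partial j (christoffel k i k) y) +
  \sum_k \sum_l (christoffel k k l y * christoffel l i j y
                 - christoffel k j l y * christoffel l i k y).

Definition scalar_curvature (y : 'rV[R]_n) : R :=
  \sum_i \sum_j invmx (G y) i j * ricci i j y.

End Curvature.

Definition scal (R : realType) (n : nat) (X : charted R n) (g : metric_data X)
    (i : index X) (x : X) : R := scalar_curvature (g i) (chart i x).

Definition has_scal (R : realType) (n : nat) (X : charted R n)
    (g : metric_data X) (f : X -> R) : Prop :=
  forall i x, chart_dom i x -> scal g i x = f x.

Definition scal_nonneg (R : realType) (n : nat) (X : charted R n)
    (g : metric_data X) : Prop :=
  forall i x, chart_dom i x -> 0 <= scal g i x.

Section Sphere.
Variables (R : realType) (n : nat).

Definition unit_sphere : set 'rV[R]_n.+1 := [set x | \sum_i x 0 i ^+ 2 = 1].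

Arguments unit_sphere : clear implicits.

Definition sphere_val (x : set_type unit_sphere) : 'rV[R]_n.+1 := set_val x.

(* The chart of index b is the stereographic projection from (-1)^b e_0. *)
Definition sphere : charted R n :=
  @Charted R n (set_type unit_sphere) bool
    (fun b => [set x | sphere_val x 0 0 <> (-1) ^+ b])
    (fun b x => \row_(k < n)
       (sphere_val x 0 (fintype.lift ord0 k) / (1 - (-1) ^+ b * sphere_val x 0 0))).

(* The metric induced by the Euclidean metric of R^(n+1). *)
Definition round_metric : metric_data sphere := fun b y =>
  let J := jacobian (@local_expr R n sphere 'rV[R]_n.+1 b sphere_val) y in
  J *m J^T.

End Sphere.

Section Conformal.
Variables (R : realType) (n : nat).

Definition conformal_on (X Y : charted R n) (g : metric_data X)
    (h : metric_data Y) (U : set X) (f : X -> Y) : Prop :=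
  forall x, U x -> exists2 a : R, 0 < a &
    forall i j, chart_dom i x -> chart_dom j (f x) ->
      pullback h f i j x = a *: g i (chart i x).

Variables (X : charted R n) (g : metric_data X).

Definition locally_conformally_flat : Prop :=
  forall x : X, exists (U : set X) (f : X -> sphere R n),
    [/\ open U, U x, diffeo_on U f & conformal_on g (@round_metric R n) U f].

Definition developing_map (f : X -> sphere R n) : Prop :=
  local_diffeo f /\ conformal_on g (@round_metric R n) setT f.

End Conformal.

Section Data.
Variables (R : realType) (n : nat) (K : set (sphere R n)).

Definition complement : charted R n := open_submanifold (~` K).

(* The charts of [complement] restrict those of the sphere, so round_metric is
   also the coordinate expression of the restricted round metric. *)
Definition conformal_metric (phi : complement -> R) (t : R) :
    metric_data complement := fun i y =>
  ((local_expr i phi y + t) `^ (4 / (n%:R - 2))) *: round_metric i y.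

Definition inf_fun (phi : complement -> R) : R := inf (range phi).

Definition conformal_data (phi : complement -> R) : Prop :=
  [/\ nondegenerate_continuum K /\
        hausdorff_dim (@sphere_val R n @` K) = 1%E,
      [/\ smooth_fun phi, forall x, 0 < phi x & 0 < inf_fun phi],
      [/\ contractible R complement, open_manifold complement &
          ~ simply_connected_at_infinity R complement] &
      forall t, - inf_fun phi < t ->
        [/\ riemannian_metric (conformal_metric phi t),
            complete_metric (conformal_metric phi t),
            locally_conformally_flat (conformal_metric phi t) &
            has_scal (conformal_metric phi t) (fun x =>
              n%:R * (n%:R - 1) * t *
              (phi x + t) `^ (- ((n%:R + 2) / (n%:R - 2))))]].

End Data.

Definition complete_lcf_nonneg (R : realType) (n : nat) (X : charted R n)
    (g : metric_data X) : Prop :=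
  [/\ riemannian_metric g, complete_metric g, locally_conformally_flat g &
      scal_nonneg g].

(* Main.v *)
Require Import Defs.
From HB Require Import structures.
From mathcomp Require Import all_boot all_order all_algebra.
From mathcomp Require Import all_classical all_reals all_analysis.
From mathcomp Require Import ring lra zify.
From mathcomp.multinomials Require Import freeg.

(** Singular homology and the fundamental group of M vanish because M is
    contractible: coning off simplices along the contraction gives a chain
    homotopy, and a free null-homotopy of a loop can be made based.  Completeness,
    conformal flatness and the scalar curvature are part of the data, and the
    inclusion of M is conformal because the round metric and its multiples obey
    the same change-of-chart formula.  The frontier of M is all of K because a
    piece of the sphere projects onto a planar square, hence has Hausdorff
    dimension at least 2, so that K has empty interior.  Finally R^n with n >= 3
    is simply connected at infinity, unlike M: a loop outside a large ball is
    homotopic in R^n - 0 to a polygon, the polygon lies in finitely many planes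
    through 0, so that it can be contracted to a vector v outside their union,
    and the homotopy is pushed radially out of the ball. *)

Set Implicit Arguments.
Unset Strict Implicit.
Unset Printing Implicit Defensive.

Import Order.TTheory GRing.Theory Num.Theory.
Import numFieldNormedType.Exports.

Local Open Scope classical_set_scope.
Local Open Scope ring_scope.

(** * Continuity and homotopies *)

(** Continuity of [f] is asked only relative to [A], because paths and homotopies are unconstrained
    outside [I]. *)
Lemma continuous_within_comp (T X Y : topologicalType) (A : set X) (B : set T)
    (f : X -> Y) (g : T -> X) :
  {within B, continuous g} -> (forall t, B t -> A (g t)) ->
  {within A, continuous f} -> {within B, continuous (f \o g)}.
Proof.
move=> /subspace_continuousP cg BA /subspace_continuousP cf.
apply/subspace_continuousP => t Bt.
apply: cvg_trans (cf _ (BA _ Bt)) => U /= fU.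
have /= gU := cg _ Bt _ fU.
move: gU; rewrite !nbhs_simpl /within /=.
by apply: filterS => x /= gU Bx; exact: gU Bx (BA _ Bx).
Qed.

Lemma continuous_funcomp (T X Y : topologicalType) (f : T -> X) (g : X -> Y) :
  continuous f -> continuous g -> continuous (fun x => g (f x)).
Proof. by move=> cf cg x; exact: (continuous_comp (cf x) (cg (f x))). Qed.

Lemma continuous_at_pair (T X Y : topologicalType) (f : T -> X) (g : T -> Y)
    (x : T) :
  {for x, continuous f} -> {for x, continuous g} ->
  {for x, continuous (fun x => (f x, g x))}.
Proof. by move=> cf cg; apply: cvg_pair; [exact: cf|exact: cg]. Qed.

Lemma continuous_pair (T X Y : topologicalType) (f : T -> X) (g : T -> Y) :
  continuous f -> continuous g -> continuous (fun x => (f x, g x)).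
Proof. by move=> cf cg x; exact: continuous_at_pair (cf x) (cg x). Qed.

Lemma within_continuous_pair (T X Y : topologicalType) (A : set T)
    (f : T -> X) (g : T -> Y) :
  {within A, continuous f} -> {within A, continuous g} ->
  {within A, continuous (fun x => (f x, g x))}.
Proof. by move=> cf cg x; apply: cvg_pair; [exact: cf|exact: cg]. Qed.

Lemma continuous_minr (R : realType) (T : topologicalType) (f g : T -> R) :
  continuous f -> continuous g -> continuous (fun x => Num.min (f x) (g x)).
Proof. by move=> cf cg x; exact: (continuous_min (cf x) (cg x)). Qed.

Lemma continuous_maxr (R : realType) (T : topologicalType) (f g : T -> R) :
  continuous f -> continuous g -> continuous (fun x => Num.max (f x) (g x)).
Proof. by move=> cf cg x; exact: (continuous_max (cf x) (cg x)). Qed.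

Lemma continuous_addr (K : numFieldType) (V : normedModType K)
    (T : topologicalType) (f g : T -> V) :
  continuous f -> continuous g -> continuous (fun x => f x + g x).
Proof. by move=> cf cg x; exact: (continuousD (cf x) (cg x)). Qed.

Lemma continuous_oppr (K : numFieldType) (V : normedModType K)
    (T : topologicalType) (f : T -> V) :
  continuous f -> continuous (fun x => - f x).
Proof. by move=> cf x; exact: (continuousN (cf x)). Qed.

Lemma continuous_mulr (K : numFieldType) (T : topologicalType) (f g : T -> K) :
  continuous f -> continuous g -> continuous (fun x => f x * g x).
Proof. by move=> cf cg x; exact: (continuousM (cf x) (cg x)). Qed.

Lemma continuous_normr (K : numFieldType) (V : normedModType K)
    (T : topologicalType) (f : T -> V) :
  continuous f -> continuous (fun x => `|f x|).
Proof. by move=> cf x; apply: cvg_norm; exact: cf. Qed.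

Lemma continuous_scaler (K : numFieldType) (V : normedModType K)
    (T : topologicalType) (f : T -> K) (g : T -> V) :
  continuous f -> continuous g -> continuous (fun x => f x *: g x).
Proof. by move=> cf cg x; exact: (continuousZ (cf x) (cg x)). Qed.

Lemma continuous_sumr (K : numFieldType) (V : normedModType K)
    (T : topologicalType) (I : Type) (r : seq I) (f : I -> T -> V) :
  (forall i, continuous (f i)) -> continuous (fun x => \sum_(i <- r) f i x).
Proof.
move=> cf; elim: r => [|i r IHr].
  by under eq_fun do rewrite big_nil; move=> x; exact: cst_continuous.
by under eq_fun do rewrite big_cons; apply: continuous_addr.
Qed.

Lemma continuous_fst (T U : topologicalType) : continuous (fun p : T * U => p.1).
Proof. by move=> p; exact: cvg_fst. Qed.

Lemma continuous_snd (T U : topologicalType) : continuous (fun p : T * U => p.2).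
Proof. by move=> p; exact: cvg_snd. Qed.

Ltac continuity := repeat first
  [ assumption
  | by move=> ?; exact: cst_continuous
  | by move=> ?; exact: cvg_id
  | exact: continuous_fst
  | exact: continuous_snd
  | apply: continuous_pair
  | apply: continuous_addr
  | apply: continuous_oppr
  | apply: continuous_mulr
  | apply: continuous_normr
  | apply: continuous_scaler
  | apply: continuous_minr
  | apply: continuous_maxr ].

(** The pasting lemma for the closed sets [h <= a] and [a <= h]. *)
Lemma continuous_if_le (R : realType) (T X : topologicalType) (h : T -> R) (a : R)
    (f g : T -> X) :
  continuous h -> continuous f -> continuous g ->
  (forall x, h x = a -> f x = g x) ->
  continuous (fun x => if h x <= a then f x else g x).
Proof.
move=> /continuous_closedP ch cf cg fg; apply/continuous_subspace_setT.
rewrite (_ : [set: T] = [set x | h x <= a] `|` [set x | a <= h x]); last first.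
  apply/seteqP; split=> // x _ /=; have [] := leP (h x) a; first by left.
  by move=> /ltW; right.
apply: withinU_continuous.
- exact: (ch [set y | y <= a] (@closed_le R a)).
- exact: (ch [set y | a <= y] (@closed_ge R a)).
- apply: subspace_eq_continuous (continuous_subspaceT cf) => x.
  by rewrite inE /= /from_subspace => ->.
- apply: subspace_eq_continuous (continuous_subspaceT cg) => x.
  rewrite inE /= /from_subspace => ax; case: ifP => // xa.
  by rewrite fg//; apply/eqP; rewrite eq_le xa.
Qed.

(** * Based null-homotopies and contractions *)

Section Homotopy.
Variables (R : realType) (X : topologicalType).
Local Notation I := (`[0, 1]%classic : set R).

Lemma path_connected_connected : path_connected R X -> connected [set: X].
Proof.
move=> pX; have [[x0 _]|X0] := pselect (exists x : X, True); last first.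
  rewrite (_ : [set: X] = set0); first exact: connected0.
  by apply/seteqP; split=> // x _; apply: X0; exists x.
pose S (c : R -> X) : set X := c @` I.
rewrite (_ : [set: X] = \bigcup_(c in [set c : R -> X | is_path c /\ c 0 = x0]) S c).
  apply: bigcup_connected.
    by exists x0 => c [_ <-]; exists 0 => //=; rewrite in_itv/= lexx ler01.
  move=> c [cc _]; apply: connected_continuous_connected => //.
  exact: segment_connected.
apply/seteqP; split=> // x _; have [c [cc c0 c1]] := pX x0 x.
by exists c => //; exists 1 => //=; rewrite in_itv/= lexx ler01.
Qed.

(** Retraction of the line onto [I]: precomposing with it turns continuity within [I] into
    continuity everywhere. *)
Let clamp (u : R) : R := Num.max 0 (Num.min 1 u).

Let clampI u : I (clamp u).
Proof. by rewrite /clamp/= in_itv/= le_max lexx/= ge_max ler01/= ge_min lexx. Qed.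

Let clamp_id u : I u -> clamp u = u.
Proof.
rewrite /clamp /= in_itv /= => /andP[u0 u1].
by rewrite min_r// max_r.
Qed.

Let clamp0 u : u <= 0 -> clamp u = 0.
Proof. by move=> u0; rewrite /clamp max_l// ge_min u0 orbT. Qed.

Let clamp1 u : 1 <= u -> clamp u = 1.
Proof. by move=> u0; rewrite /clamp min_l// max_r. Qed.

Let continuous_clamp : continuous clamp.
Proof. by rewrite /clamp; continuity. Qed.

(* For t <= 1/2 both ends of the loop F (_, t) are joined to the base point along
   the track F (0, _) = F (1, _); for t >= 1/2 that track is retracted. *)
Lemma null_homotopic_of_free (A : set X) (c : R -> X) (x0 : X) (F : R * R -> X) :
  {within I `*` I, continuous F} ->
  (forall s t, I s -> I t -> A (F (s, t))) ->
  (forall s, I s -> F (s, 0) = c s) -> (forall s, I s -> F (s, 1) = x0) ->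
  (forall t, I t -> F (0, t) = F (1, t)) ->
  null_homotopic_in A c.
Proof.
move=> cF AF Fc Fx0 Floop.
have I0 : I 0 by rewrite /= in_itv /= lexx ler01.
have I1 : I 1 by rewrite /= in_itv /= lexx ler01.
pose G (p : R * R) := F (clamp p.1, clamp p.2).
have cG : continuous G.
  apply/continuous_subspace_setT.
  apply: (continuous_within_comp (A := I `*` I) (g := fun p => (clamp p.1, clamp p.2))).
  - apply: continuous_subspaceT; apply: continuous_pair => p.
      by apply: continuous_comp; [exact: cvg_fst|exact: continuous_clamp].
    by apply: continuous_comp; [exact: cvg_snd|exact: continuous_clamp].
  - by move=> p _; split; exact: clampI.
  - exact: cF.
have AG p : A (G p) by exact: AF.
(* The tent [m] vanishes at both ends of [I] and is at least 1 on the middle third. So at t = 1/2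
   the outer thirds run along the track and back, and the middle third stays at [x0]. *)
pose m (s : R) : R := Num.min (3 * s) (3 * (1 - s)).
have cm : continuous m by rewrite /m; continuity.
have cmfst : continuous (fun p : R * R => m p.1).
  by move=> p; apply: continuous_comp; [exact: continuous_fst|exact: cm].
(* The first coordinate is s at t = 0 and 3 s - 1 at t = 1/2; [clamp] cuts off what leaves [I]. *)
pose p1 (p : R * R) : R * R :=
  ((1 + 4 * p.2) * p.1 - 2 * p.2, Num.min (2 * p.2) (m p.1)).
pose p2 (p : R * R) : R * R := (0, Num.min (2 - 2 * p.2) (m p.1)).
have cp1 : continuous p1 by rewrite /p1; continuity.
have cp2 : continuous p2 by rewrite /p2; continuity.
pose H p := if p.2 <= 2^-1 then G (p1 p) else G (p2 p).
have agree s : G (p1 (s, 2^-1)) = G (p2 (s, 2^-1)).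
  rewrite /G /= /m.
  have -> : 2 * 2^-1 = 1 :> R by field.
  have -> : 2 - 1 = 1 :> R by lra.
  have -> : (1 + 4 * 2^-1) * s - 1 = 3 * s - 1 :> R by field.
  have [s13|s13] := leP s 3^-1.
    rewrite (clamp0 (u := 3 * s - 1)) ?(clamp0 (u := 0))//; lra.
  have [s23|s23] := leP (2 / 3) s.
    by rewrite (clamp1 (u := 3 * s - 1)) ?(clamp0 (u := 0)) ?Floop//; lra.
  rewrite (clamp1 (u := Num.min _ _)); first by rewrite !Fx0//; exact: clampI.
  by rewrite !le_min; apply/and3P; split; lra.
have cH : continuous H.
  apply: continuous_if_le => //; first exact: continuous_snd.
  - by move=> x; apply: continuous_comp; [exact: cp1|exact: cG].
  - by move=> x; apply: continuous_comp; [exact: cp2|exact: cG].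
  - by move=> [s t] /= ->; exact: agree.
have m0 : m 0 = 0 by rewrite /m mulr0 min_l// subr0 mulr1.
have m1 : m 1 = 0 by rewrite /m subrr mulr0 min_r// mulr1.
have G00 : G (0, 0) = c 0 by rewrite /G /= !clamp_id// Fc.
have G2 u : u <= 0 -> G (0, u) = c 0.
  by move=> u0; rewrite -G00 /G/= !(clamp0 (u := u))// (clamp0 (u := 0)).
exists H; split.
- exact: continuous_subspaceT.
- by move=> s t _ _; rewrite /H; case: ifP.
- move=> s Is; have := Is; rewrite /= in_itv/= => /andP[s0 s1].
  rewrite /H/= invr_ge0 ler0n; split.
    rewrite /p1/= !mulr0 subr0 addr0 mul1r min_l; last first.
      by rewrite le_min; apply/andP; split; lra.
    by rewrite /G /= !clamp_id// Fc.
  rewrite ifF; last by apply/negP => ?; lra.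
  by apply: G2; rewrite ge_min mulr1 subrr lexx.
- move=> t It; have := It; rewrite /= in_itv/= => /andP[t0 t1].
  rewrite /H/=; case: ifPn => t2; split.
  + rewrite /p1 /= m0 mulr0 add0r min_r; last lra.
    by rewrite /G/= (clamp0 (u := - _)) ?(clamp_id I0) ?Fc//; lra.
  + rewrite /p1 /= m1 min_r; last lra.
    by rewrite /G/= (clamp1 (u := _ - _)) ?(clamp_id I0) -?Floop ?Fc//; lra.
  + by apply: G2; rewrite ge_min m0 lexx orbT.
  + by apply: G2; rewrite ge_min m1 lexx orbT.
Qed.

Lemma contractible_contraction : contractible R X ->
  exists (x0 : X) (H : X * R -> X),
    [/\ continuous H, forall x, H (x, 0) = x & forall x, H (x, 1) = x0].
Proof.
move=> [x0 [H [cH H0 H1]]]; exists x0, (fun p => H (p.1, clamp p.2)); split.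
- apply/continuous_subspace_setT.
  apply: (continuous_within_comp (A := setT `*` I) (g := fun p => (p.1, clamp p.2))).
  + by apply: continuous_subspaceT; continuity.
  + by move=> p _; split => //; exact: clampI.
  + exact: cH.
- by move=> x; rewrite clamp0.
- by move=> x; rewrite clamp1.
Qed.

Lemma contractible_path_connected : contractible R X -> path_connected R X.
Proof.
move=> /contractible_contraction[x0 [H [cH H0 H1]]] x y.
have Hz (z : X) (f : R -> R) : continuous f -> continuous (fun u => H (z, f u)).
  move=> cf u; apply: (@continuous_comp _ _ _ (fun u => (z, f u))); last exact: cH.
  by move: u; continuity.
exists (fun u => if u <= 2^-1 then H (x, 2 * u) else H (y, 2 - 2 * u)); split.
- apply: continuous_subspaceT; apply: continuous_if_le.
  + continuity.
  + by apply: Hz; continuity.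
  + by apply: Hz; continuity.
  + move=> u ->; have -> : 2 - 2 * 2^-1 = 1 :> R by field.
    by rewrite mulfV// !H1.
- by rewrite invr_ge0 ler0n mulr0.
- by rewrite ifF ?mulr1 ?subrr//; apply/negP => ?; lra.
Qed.

Lemma contractible_simply_connected : contractible R X -> simply_connected R X.
Proof.
move=> cX; split; first exact: contractible_path_connected.
have [x0 [H [cH H0 H1]]] := contractible_contraction cX; move=> c [cc c01].
apply: (null_homotopic_of_free (x0 := x0) (F := fun p => H (c p.1, p.2))) => //=.
  apply: (continuous_within_comp (A := setT) (g := fun p => (c p.1, p.2))) => //.
    apply: within_continuous_pair; last exact/continuous_subspaceT/continuous_snd.
    apply: (continuous_within_comp (A := I) (g := fst)) => //.
      exact/continuous_subspaceT/continuous_fst.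
    by move=> p [].
  exact: continuous_subspaceT.
by rewrite c01.
Qed.

End Homotopy.

(** * Singular homology of contractible spaces *)

Lemma continuous_at_row (K : numFieldType) (T : topologicalType) (n : nat)
    (f : T -> 'rV[K]_n) (x : T) :
  (forall i, {for x, continuous (fun y => f y 0 i)}) -> {for x, continuous f}.
Proof.
move=> cf U [P xP PU]; rewrite nbhs_simpl /=.
have : \forall y \near x, forall i, P 0 i (f y 0 i).
  by apply: filter_forall => i; exact: cf (xP 0 i).
by apply: filterS => y Py; apply: PU => i j; rewrite (ord1 i).
Qed.

Lemma continuous_at_set_type (T Y : topologicalType) (A : set Y) (f : T -> A)
    (x : T) :
  {for x, continuous (fun y => set_val (f y))} -> {for x, continuous f}.
Proof.
move=> cf U [_ [/= [V oV <-] Vx VU]]; rewrite nbhs_simpl /=.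
have : \forall y \near x, V (set_val (f y)) by apply: cf; exact: open_nbhs_nbhs.
by apply: filterS => y Vy; exact: VU.
Qed.

(** A closed subset of the unit cube. Compactness is what makes cones continuous at the apex. *)
Lemma std_simplex_compact (R : realType) k : compact (@std_simplex R k).
Proof.
have cube : compact [set v : 'rV[R]_k.+1 | forall i, `[0, 1]%classic (v 0 i)].
  by apply: (@rV_compact R k.+1 (fun=> `[0, 1]%classic)) => _; exact: segment_compact.
apply: (subclosed_compact _ cube).
  rewrite (_ : @std_simplex R k = (\bigcap_i [set x : 'rV[R]_k.+1 | 0 <= x 0 i]) `&`
    [set x : 'rV[R]_k.+1 | \sum_i x 0 i = 1]); last first.
    apply/seteqP; split => x [x0 x1]; split => //; last by move=> i; exact: x0.
    by move=> i _; exact: x0.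
  have cx (i : 'I_k.+1) : continuous (fun x : 'rV[R]_k.+1 => x 0 i).
    exact: coord_continuous.
  apply: closedI.
    apply: closed_bigI => i _.
    have /continuous_closedP/(_ [set y | 0 <= y]) := cx i.
    by apply; exact: closed_ge.
  have csum : continuous (fun x : 'rV[R]_k.+1 => \sum_i x 0 i).
    exact: continuous_sumr.
  have /continuous_closedP/(_ [set y | y = 1]) := csum.
  by apply; exact: closed_eq.
move=> x [x0 x1] i; rewrite /= in_itv /= x0 -x1 (bigD1 i) //=.
by rewrite lerDl sumr_ge0.
Qed.

(** With the next lemma: deleting vertex j + 1 keeps vertex 0 and deletes vertex j among the others,
    which gives the face relations of cones. *)
Lemma unlift_lift0 n (j : 'I_n.+1) :
  unlift (fintype.lift ord0 j) ord0 = Some (ord0 : 'I_n.+1).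
Proof.
case: unliftP => [i /(congr1 val) /=|/(congr1 val)//].
by rewrite /bump => i0; congr Some; apply: val_inj => /=; move: i0; case: ltnP; lia.
Qed.

Lemma unlift_lift n (i j : 'I_n.+1) :
  unlift (fintype.lift ord0 j) (fintype.lift ord0 i)
  = omap (fintype.lift ord0) (unlift j i).
Proof.
case: (unliftP j i) => [k ->|->]; last by rewrite unlift_none.
rewrite (_ : fintype.lift ord0 (fintype.lift j k) =
  fintype.lift (fintype.lift ord0 j) (fintype.lift ord0 k)) ?liftK//.
by apply: val_inj; rewrite /= /bump /= !add1n ltnS addnS.
Qed.

Section FreeAbelianLift.
Variables (T : choiceType) (M : lmodType int) (f : T -> M).

(** Lets the [raddf] lemmas apply to [singular_boundary] and [chain_cone] once these are unfolded to
    [fglift]. *)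
HB.instance Definition _ := GRing.isAdditive.Build {freeg T / int} M (fglift f)
  (lift_is_additive f).

Lemma fgliftZ z D : fglift f (z *: D) = z *: fglift f D.
Proof. by rewrite -(intz z) !scaler_int raddfMz. Qed.

Lemma freegUZ z (x : T) : << z *g x >> = z *: << x >> :> {freeg T / int}.
Proof. by apply/eqP/freeg_eqP => y; rewrite coeffZ !coeffU mul1r. Qed.

End FreeAbelianLift.

(** * The cone operator of a contraction *)

Section Cone.
Variables (R : realType) (X : topologicalType) (x0 : X) (H : X * R -> X).
Hypotheses (cH : continuous H) (H0 : forall x, H (x, 0) = x)
  (H1 : forall x, H (x, 1) = x0).

(* Projection from the cone point e_0 onto the opposite face; the value at the
   cone point itself is junk. *)
Definition link_row k (x : 'rV[R]_k.+2) : 'rV[R]_k.+1 :=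
  if x 0 ord0 == 1 then delta_mx 0 ord0
  else \row_i (x 0 (fintype.lift ord0 i) / (1 - x 0 ord0)).

Lemma link_row_simplex k (x : @std_simplex R k.+1) :
  link_row (set_val x) \in @std_simplex R k.
Proof.
have [x_ge0 x1] := set_valP x; apply/mem_set.
rewrite /link_row; case: eqVneq => [_|x01].
  split=> [i|]; first by rewrite mxE; case: (_ && _); rewrite ?ler01.
  rewrite (bigD1 ord0)//= mxE !eqxx big1 ?addr0// => i i0.
  by rewrite mxE (negbTE i0) andbF.
move: x1; rewrite big_ord_recl => x1.
have {}x1 : \sum_i set_val x 0 (fintype.lift ord0 i) = 1 - set_val x 0 ord0.
  by rewrite -x1 addrAC subrr add0r.
split=> [i|]; rewrite ?mxE.
  by rewrite divr_ge0// -x1 sumr_ge0.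
under eq_bigr do rewrite mxE.
by rewrite -mulr_suml x1 divff// subr_eq0 eq_sym.
Qed.

Definition link k (x : @std_simplex R k.+1) : @std_simplex R k :=
  exist _ (link_row (set_val x)) (link_row_simplex x).

(** The barycentric coordinate of vertex 0 is the time of the contraction: the opposite face carries
    [s], the apex goes to [x0]. *)
Definition cone_fun k (s : @std_simplex R k -> X) (x : @std_simplex R k.+1) : X :=
  H (s (link x), set_val x 0 ord0).

Lemma link_continuous_at k (x : @std_simplex R k.+1) :
  set_val x 0 ord0 != 1 -> {for x, continuous (@link k)}.
Proof.
move=> x1; apply: continuous_at_set_type; apply: continuous_at_row => i.
have cx (j : 'I_k.+2) :
    {for x, continuous (fun y : @std_simplex R k.+1 => set_val y 0 j)}.
  apply: (@continuous_comp _ _ _ set_val (fun v : 'rV[R]_k.+2 => v 0 j)).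
    exact: initial_continuous.
  exact: coord_continuous.
pose g (y : @std_simplex R k.+1) :=
  set_val y 0 (fintype.lift ord0 i) / (1 - set_val y 0 ord0).
have gE (y : @std_simplex R k.+1) : set_val y 0 ord0 != 1 ->
    g y = set_val (link y) 0 i.
  move=> y1; rewrite /g (_ : set_val (link y) = link_row (set_val y))//.
  by rewrite /link_row (negbTE y1) mxE.
have cg : {for x, continuous g}.
  apply: continuousM; first exact: (cx (fintype.lift ord0 i)).
  apply: continuousV; first by rewrite subr_eq0 eq_sym.
  by apply: continuousB; [exact: cst_continuous|exact: (cx ord0)].
move: cg; rewrite /prop_for /continuous_at gE// => cg.
apply: cvg_trans cg; apply: (@near_eq_cvg _ _ (nbhs x)).
have near1 : \forall y \near x, set_val (y : @std_simplex R k.+1) 0 ord0 != 1.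
  apply: (cx ord0 [set t | t != 1]); apply: open_nbhs_nbhs.
  by split => //; exact: open_neq.
by near=> y; apply: gE; near: y; exact: near1.
Unshelve. all: by end_near.
Qed.

(* [link] has no limit at the cone point; there continuity comes from the tube
   lemma on the compact simplex, since H (_, 1) is constant. *)
Lemma cone_continuous k (s : @std_simplex R k -> X) :
  continuous s -> continuous (cone_fun s).
Proof.
move=> cs x.
have cx : {for x, continuous (fun y : @std_simplex R k.+1 => set_val y 0 ord0)}.
  apply: (@continuous_comp _ _ _ set_val (fun v : 'rV[R]_k.+2 => v 0 ord0)).
    exact: initial_continuous.
  exact: coord_continuous.
have [x1|x1] := eqVneq (set_val x 0 ord0) 1; last first.
  apply: (@continuous_comp _ _ _ (fun y => (s (link y), set_val y 0 ord0)) H);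
    last exact: cH.
  apply: continuous_at_pair; last exact: cx.
  by apply: (@continuous_comp _ _ _ (@link k) s); [exact: link_continuous_at|exact: cs].
(* [valL_ x0 s] extends [s] from the subtype to all row vectors, since the compactness result
   concerns a subset of that space. *)
have cf : {within @std_simplex R k, continuous (valL_ x0 s)}.
  exact/subspace_valL_continuousP'.
rewrite /prop_for /continuous_at /cone_fun x1 H1 => U Ux0.
have /compact_near_coveringP/near_covering_withinP := @std_simplex_compact R k.
(* For t near 1, all points of the simplex are sent into [U] at once; the behaviour of [link] is
   then irrelevant. *)
move=> /(_ R (nbhs (1 : R)) (fun t v => U (H (valL_ x0 s v, t)))).
case.
  move=> v vk.
  have : nbhs (H (valL_ x0 s v, 1)) U by rewrite H1.
  move=> /cH[[V W] /= [nV nW] VWU].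
  have nsV := (subspace_continuousP _ _).1 cf v vk V nV.
  exists ([set w | std_simplex w -> V (valL_ x0 s w)], W) => //=.
  by move=> [w t] /= [wV tW] wk; apply: VWU; split => //=; exact: wV.
move=> e /= e0 eU.
have near1 : \forall y \near x,
    ball (1 : R) e (set_val (y : @std_simplex R k.+1) 0 ord0).
  by apply: cx; rewrite x1; exact: nbhsx_ballx.
rewrite nbhs_simpl /=; move: near1.
apply: (@filterS _ (nbhs x)) => y yU.
have vE : valL_ x0 s (set_val (link y)) = s (link y).
  exact: (congr1 (fun f => f (link y)) (valLK x0 s)).
by rewrite /= -vE; exact: (eU _ yU _ (set_valP _)).
Qed.

Definition cone k (s : singular_simplex R X k) : singular_simplex R X k.+1 :=
  exist _ _ (cone_continuous (proj2_sig s)).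

Lemma singular_simplex_inj k (s s' : singular_simplex R X k) :
  (forall x, sval s x = sval s' x) -> s = s'.
Proof.
by move=> ss'; apply: eq_sig_hprop; [move=> f; exact: Prop_irrelevance|exact/funext].
Qed.

Lemma singular_face0_cone k (s : singular_simplex R X k) :
  singular_face ord0 (cone s) = s.
Proof.
apply: singular_simplex_inj => x.
have x0E : set_val (face ord0 x) 0 ord0 = 0 by rewrite /= mxE unlift_none.
have linkE : link (face ord0 x) = x.
  apply: val_inj => /=; rewrite /link_row x0E eq_sym oner_eq0.
  by apply/rowP => i; rewrite !mxE liftK subr0 divr1.
by rewrite /= /cone_fun linkE x0E H0.
Qed.

Lemma singular_face_cone k (s : singular_simplex R X k.+1) (j : 'I_k.+2) :
  singular_face (fintype.lift ord0 j) (cone s) = cone (singular_face j s).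
Proof.
apply: singular_simplex_inj => x.
have x0E : set_val (face (fintype.lift ord0 j) x) 0 ord0 = set_val x 0 ord0.
  by rewrite /= mxE unlift_lift0.
rewrite /= /cone_fun x0E.
(* At the apex the two links are junk and need not match, but both sides equal [x0]. *)
have [->|x1] := eqVneq (set_val x 0 ord0) 1; first by rewrite !H1.
congr (H (sval s _, _)); apply: val_inj => /=.
rewrite /link_row x0E (negbTE x1).
apply/rowP => i; rewrite !mxE unlift_lift.
case: unliftP => [i' _|_] /=; last by rewrite mul0r.
rewrite (_ : set_val (link x) 0 i' = link_row (set_val x) 0 i')//.
by rewrite /link_row (negbTE x1) mxE.
Qed.

(** Deleting the only base vertex of a 1-simplex leaves the apex; this face produces the
    augmentation term in degree 0. *)
Lemma singular_face1_cone (s s' : singular_simplex R X 0) :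
  (forall x, sval s' x = x0) ->
  singular_face (fintype.lift ord0 ord0) (cone s) = s'.
Proof.
move=> s'E; apply: singular_simplex_inj => x; rewrite s'E.
have x0E : set_val (face (fintype.lift ord0 ord0) x) 0 ord0 = 1.
  rewrite /= mxE unlift_lift0; have [_] := set_valP x.
  by rewrite big_ord1.
by rewrite /= /cone_fun x0E H1.
Qed.

Definition chain_cone k : chain R X k -> chain R X k.+1 :=
  fglift (fun s : {classic (singular_simplex R X k)} =>
    << (cone s : {classic (singular_simplex R X k.+1)}) >>).

(** Face 0 of the cone is the base; the other faces are cones on the faces of [s], with signs
    changed by the index shift. *)
Lemma boundary_chain_coneU k z (s : {classic (singular_simplex R X k.+1)}) :
  singular_boundary (chain_cone << z *g s >>) =
  << z *g s >> - chain_cone (singular_boundary << z *g s >>).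
Proof.
rewrite /chain_cone /singular_boundary (freegUZ z s) !fgliftZ !liftU !scale1r.
rewrite liftU scale1r -scalerBr big_ord_recl expr0 singular_face0_cone.
congr (_ *: (_ + _)).
rewrite raddf_sum /= -sumrN; apply: eq_bigr => j _.
by rewrite liftU singular_face_cone -freegUZ freegUN exprS mulN1r.
Qed.

(** The cone operator is a chain homotopy between the identity and 0 in positive degrees. *)
Lemma boundary_chain_cone k (c : chain R X k.+1) :
  singular_boundary (chain_cone c) = c - chain_cone (singular_boundary c).
Proof.
elim/freeg_ind_dom0: c => [|z s c _ _ IHc].
  by rewrite /chain_cone /singular_boundary !raddf0 addr0.
move: IHc (boundary_chain_coneU z s).
rewrite /chain_cone /singular_boundary !raddfD /= => -> ->.
by rewrite addrACA.
Qed.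

Lemma boundary_chain_cone0 (s' : {classic (singular_simplex R X 0)})
    (c : chain R X 0) : (forall x, sval s' x = x0) ->
  singular_boundary (chain_cone c) = c - << deg c *g s' >>.
Proof.
move=> s'E; elim/freeg_ind_dom0: c => [|z s c _ _ IHc].
  by rewrite /chain_cone /singular_boundary !raddf0 freegU0 subr0.
rewrite degD degU -freegUD opprD addrACA -IHc.
rewrite /chain_cone /singular_boundary !raddfD /=; congr (_ + _).
rewrite (freegUZ z s) (freegUZ z s') !fgliftZ !liftU !scale1r liftU scale1r.
rewrite -scalerBr big_ord_recl big_ord1 expr0 expr1.
by rewrite singular_face0_cone (singular_face1_cone _ s'E) freegUN.
Qed.

End Cone.

(** A cycle bounds its own cone; in degree 0 the correction is a multiple of [deg c], which
    vanishes. *)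
Lemma contractible_acyclic (R : realType) (X : topologicalType) k :
  contractible R X -> reduced_homology_trivial R X k.
Proof.
move=> /contractible_contraction[x0 [H [cH H0 H1]]]; case: k => [|k] c /= c0.
  have cx0 : continuous (fun _ : @std_simplex R 0 => x0).
    by move=> x; exact: cst_continuous.
  pose s' : singular_simplex R X 0 := exist _ _ cx0.
  exists (chain_cone cH H1 c).
  by rewrite (boundary_chain_cone0 cH H0 H1 (s' := s'))// c0 freegU0 subr0.
exists (chain_cone cH H1 c).
by rewrite boundary_chain_cone// c0 /chain_cone raddf0 subr0.
Qed.

(** * Simple connectivity at infinity of R^n *)

(** In characteristic 0 the first [size p] natural numbers are distinct, and they outnumber the
    roots of [p]. *)
Lemma exists_nonroot (F : numFieldType) (p : {poly F}) :
  p != 0 -> exists t, p.[t] != 0.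
Proof.
move=> p0; apply: contrapT => /forallNP np.
pose rs := [seq i%:R : F | i <- iota 0 (size p)].
suff : (size rs < size p)%N by rewrite size_map size_iota ltnn.
apply: max_poly_roots => //.
  by apply/allP => t _; rewrite /root; apply/negPn/negP => /np.
by rewrite map_inj_uniq ?iota_uniq// => i j /eqP; rewrite eqr_nat => /eqP.
Qed.

(* Each plane is annihilated by a nonzero linear form w, whose restriction to the
   moment curve (1, t, ..., t^(n-1)) is a nonzero polynomial in t. *)
Lemma exists_avoiding_planes (F : numFieldType) n (s : seq ('rV[F]_n * 'rV[F]_n)) :
  (2 < n)%N ->
  exists v : 'rV[F]_n, forall p, p \in s -> forall a b, v != a *: p.1 + b *: p.2.
Proof.
move=> n2.
have ann (p : 'rV[F]_n * 'rV[F]_n) :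
    exists w : 'cV[F]_n, [/\ w != 0, p.1 *m w = 0 & p.2 *m w = 0].
  (* [A] has only two columns, so its rank is below n and its left kernel contains a nonzero
     vector. *)
  pose A := (col_mx p.1 p.2)^T.
  have : kermx A != 0.
    rewrite kermx_eq0 /row_free; apply/eqP => rA.
    by have := rank_leq_col A; rewrite rA; move: n2; case: (n) => [|[|[|]]].
  rewrite -submx0 => /row_subPn[i]; rewrite submx0 => wi.
  have := mulmx_ker A; move=> /(congr1 (row i)); rewrite row_mul row0.
  move=> /(congr1 trmx); rewrite trmx_mul trmxK mul_col_mx trmx0 -col_mx0.
  move=> /eq_col_mx[p1w p2w].
  by exists (row i (kermx A))^T; split=> //; rewrite trmx_eq0.
have [w Hw] := choice ann.
pose P p := \poly_(i < n) (if insub i is Some j then w p j 0 else 0).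
have PE p t : (P p).[t] = ((\row_(i < n) t ^+ i) *m w p) 0 0.
  rewrite /P horner_poly mxE; apply: eq_bigr => i _.
  by rewrite !mxE mulrC valK.
have P0 p : P p != 0.
  have [w0 _ _] := Hw p.
  apply: contra_neq w0 => Pp; apply/colP => i; rewrite mxE.
  have := congr1 (fun q : {poly F} => q`_i) Pp.
  by rewrite coef_poly ltn_ord valK coef0.
(* A nonroot of the product serves all planes simultaneously. *)
have : \prod_(p <- s) P p != 0 by rewrite prodf_seq_neq0; apply/allP => p _; rewrite P0.
move=> /exists_nonroot[t]; rewrite horner_prod prodf_seq_neq0 => /allP st.
exists (\row_(i < n) t ^+ i) => p /st /= pt a b.
apply: contra pt => /eqP vE; rewrite PE vE mulmxDl -!scalemxAl.
by have [_ -> ->] := Hw p; rewrite !scaler0 addr0 mxE.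
Qed.

(** * Polygonal approximation of loops *)

Section LoopApproximation.
Variables (R : realType) (V : normedModType R).
Local Notation I := (`[0, 1]%classic : set R).

(** Heine-Cantor, with the filter [0^'+] running over the candidate moduli [d]. *)
Lemma segment_unif_continuous (c : R -> V) (e : R) :
  0 < e -> {within I, continuous c} ->
  exists2 d, 0 < d &
    forall s t, I s -> I t -> `|s - t| < d -> `|c s - c t| < e.
Proof.
move=> e0 /subspace_continuousP cc.
have := @segment_compact R 0 1; rewrite compact_near_coveringP -near_covering_withinP.
move=> /(_ R (0^'+) (fun d s => forall t, I t -> `|s - t| < d -> `|c s - c t| < e)).
case.
  move=> s Is.
  have /cvgrPdist_lt/(_ (e / 2)) := cc s Is; rewrite divr_gt0// => /(_ isT).
  move=> [/= r r0 rI].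
  have r20 : 0 < r / 2 by rewrite divr_gt0.
  exists (ball s (r / 2), [set d | d < r / 2]).
    by split; [exact: nbhsx_ballx|exact: nbhs_right_lt].
  move=> [s' d] /= [ss' dr] Is' t It s't.
  have cs' : `|c s - c s'| < e / 2.
    by apply: rI => //=; apply: lt_trans ss' _; lra.
  have ct : `|c s - c t| < e / 2.
    apply: rI => //=; have := ler_distD s' s t; move: ss' dr; rewrite /ball/=; lra.
  have := ler_distD (c s) (c s') (c t); rewrite (distrC (c s') (c s)); lra.
move=> d /= d0 dI; exists (d / 2); first by rewrite divr_gt0.
move=> s t Is It st; apply: (dI (d / 2)) => //=; last by rewrite divr_gt0.
by rewrite sub0r normrN gtr0_norm ?divr_gt0//; lra.
Qed.

(** The piecewise linear nodal function at k. Sums of these describe a polygon by one formula,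
    continuous on the whole line. *)
Definition hat (k : nat) (u : R) : R := Num.max 0 (1 - `|u - k%:R|).

Lemma hat_interpolation N k (p : nat -> V) u :
  (k < N)%N -> k%:R <= u <= k.+1%:R ->
  \sum_(i < N.+1) hat i u *: p i = (k.+1%:R - u) *: p k + (u - k%:R) *: p k.+1.
Proof.
move=> kN /andP[ku uk].
rewrite -(big_mkord xpredT (fun i => hat i u *: p i)).
rewrite (@big_cat_nat _ _ _ k)//=; last by rewrite (leq_trans (ltnW kN)).
rewrite big_nat big1 ?add0r; last first.
  move=> i /andP[_ ik]; rewrite /hat max_l ?scale0r//.
  have : i.+1%:R <= k%:R :> R by rewrite ler_nat.
  rewrite -natr1 => ?; rewrite ger0_norm; lra.
rewrite big_ltn ?(leq_trans kN)// big_ltn ?ltnS// big_nat big1 ?addr0; last first.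
  move=> i /andP[ki _]; rewrite /hat max_l ?scale0r//.
  have : k.+2%:R <= i%:R :> R by rewrite ler_nat.
  move: uk; rewrite -!natr1 => ? ?; rewrite ler0_norm; lra.
move: uk; rewrite -!natr1 => uk; rewrite /hat -natr1.
rewrite ger0_norm ?subr_ge0// max_r; last lra.
rewrite ler0_norm ?subr_le0// max_r; last lra.
by congr (_ *: _ + _ *: _); ring.
Qed.

Lemma continuous_hat k : continuous (hat k).
Proof. by rewrite /hat; continuity. Qed.

(** The inscribed polygon of small mesh stays closer to [c] than [c] stays to 0, so the straight
    homotopy misses 0. [E] lists its edges, each lying in the span of its endpoints. *)
Lemma loop_polygon (c : R -> V) :
  {within I, continuous c} -> (forall s, I s -> c s != 0) ->
  exists (q : R -> V) (E : seq (V * V)),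
    [/\ continuous q, q 0 = c 0, q 1 = c 1,
      forall s a, I s -> 0 <= a <= 1 -> (1 - a) *: c s + a *: q s != 0 &
      forall s, I s -> exists2 e, e \in E & exists a b, q s = a *: e.1 + b *: e.2].
Proof.
move=> cc c0.
have [s0 Is0 s0min] : exists2 s0, s0 \in `[0, 1] &
    forall s, s \in `[0, 1] -> `|c s0| <= `|c s|.
  apply: (@EVT_min R (fun s => `|c s|)) => //.
  apply: (@within_continuous_comp _ _ _ I c Num.norm) => //.
  by move=> x _; exact: norm_continuous.
set m := `|c s0| in s0min *.
have m0 : 0 < m by rewrite normr_gt0 c0.
have [d d0 cd] := segment_unif_continuous m0 cc.
pose N := (Num.truncn d^-1).+1.
have N0 : 0 < N%:R :> R by rewrite ltr0n.
have Nd : N%:R^-1 < d.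
  by rewrite -[ltRHS]invrK ltf_pV2 ?posrE ?invr_gt0// truncnS_gt.
pose p i := c (i%:R / N%:R).
have node i : (i <= N)%N -> I (i%:R / N%:R).
  by move=> iN; rewrite /= in_itv/= divr_ge0//= ler_pdivrMr// mul1r ler_nat.
pose q s := \sum_(i < N.+1) hat i (N%:R * s) *: p i.
have cell s : I s -> exists2 k, (k < N)%N & k%:R <= N%:R * s <= k.+1%:R.
  rewrite /= in_itv/= => /andP[s_ge0 s_le1].
  (* The end s = 1 belongs to the last cell; truncation would give k = N there. *)
  have [->|s1] := eqVneq s 1; first by exists N.-1; rewrite // mulr1 ler_nat leq_pred/=.
  exists (Num.truncn (N%:R * s)).
    rewrite -(ltr_nat R); apply: le_lt_trans (_ : N%:R * s < _).
      by rewrite truncn_le ?mulr_ge0// ltW.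
    by rewrite gtr_pMr// lt_neqAle s1.
  have Ns : 0 <= N%:R * s by rewrite mulr_ge0// ltW.
  by apply/andP; split; [rewrite truncn_le|apply: ltW; rewrite truncnS_gt].
have I0 : I 0 by rewrite /= in_itv /= lexx ler01.
have I1 : I 1 by rewrite /= in_itv /= lexx ler01.
have qE s k : (k < N)%N -> k%:R <= N%:R * s <= k.+1%:R ->
  q s = (k.+1%:R - N%:R * s) *: p k + (N%:R * s - k%:R) *: p k.+1.
  by move=> kN ks; rewrite /q (hat_interpolation _ kN).
exists q, [seq (p i, p i.+1) | i <- iota 0 N]; split.
- apply: continuous_sumr => i; apply: continuous_scaler; last first.
    by move=> ?; exact: cst_continuous.
  have cN : continuous (fun s : R => N%:R * s) by continuity.
  exact: continuous_funcomp cN (@continuous_hat i).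
- by rewrite (qE _ 0%N)// ?mulr0 ?lexx ?ler01// !subr0 scale1r scale0r addr0 /p mul0r.
- rewrite (qE _ N.-1)// ?mulr1 ?ler_nat ?leq_pred ?leqnn// subrr scale0r add0r.
  by rewrite -natr1 addrAC subrr add0r scale1r /p divff ?gt_eqF.
- move=> s a Is /andP[a_ge0 a_le1].
  have [k kN /[dup] ks /andP[ks1 ks2]] := cell s Is.
  have near_node i : (i <= N)%N -> `|i%:R - N%:R * s| <= 1 -> `|p i - c s| < m.
    move=> iN iNs; apply: cd => //; first exact: node.
    apply: le_lt_trans Nd; rewrite (_ : _ - s = (i%:R - N%:R * s) / N%:R).
      by rewrite normrM normfV normr_nat ler_piMl.
    by rewrite mulrBl (mulrC _ s) mulfK ?gt_eqF.
  move: ks1 ks2; rewrite -natr1 => ks1 ks2.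
  have pk : `|p k - c s| < m.
    by apply: near_node; [exact: ltnW|rewrite ler0_norm; lra].
  have pk1 : `|p k.+1 - c s| < m.
    by apply: near_node => //; rewrite -natr1 ger0_norm; lra.
  have qc : `|q s - c s| < m.
    rewrite (qE _ _ kN ks) -natr1; set th := N%:R * s - k%:R.
    have -> : k%:R + 1 - N%:R * s = 1 - th by rewrite /th; ring.
    have -> : (1 - th) *: p k + th *: p k.+1 - c s =
        (1 - th) *: (p k - c s) + th *: (p k.+1 - c s).
      by rewrite !scalerBr addrACA -opprD -scalerDl subrK scale1r.
    apply: le_lt_trans (ler_normD _ _) _; rewrite !normrZ.
    rewrite !ger0_norm; try by rewrite /th; lra.
    apply: (@le_lt_trans _ _ (Num.max `|p k - c s| `|p k.+1 - c s|)); last first.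
      by rewrite gt_max pk.
    set M := Num.max _ _.
    have M1 : `|p k - c s| <= M by rewrite le_max lexx.
    have M2 : `|p k.+1 - c s| <= M by rewrite le_max lexx orbT.
    have -> : M = (1 - th) * M + th * M by ring.
    by apply: lerD; apply: ler_wpM2l => //; rewrite /th; lra.
  (* If the segment met 0, [c s] would have norm less than the minimum [m]. *)
  apply/eqP => H; have csE : c s = a *: (c s - q s).
    by apply/eqP; rewrite -subr_eq0 -H scalerBr scalerBl scale1r opprB addrA addrAC.
  have := s0min _ Is; rewrite csE normrZ ger0_norm// distrC => ms.
  suff : a * `|q s - c s| <= `|q s - c s| by lra.
  by rewrite ler_piMl.
- move=> s Is; have [k kN ks] := cell s Is.
  exists (p k, p k.+1); first by apply/mapP; exists k; rewrite // mem_iota.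
  by rewrite (qE _ _ kN ks); eexists; eexists.
Qed.

End LoopApproximation.

(** * Loops and arcs avoiding the origin *)

Section PuncturedSpace.
Variables (R : realType) (n : nat).
Local Notation V := 'rV[R]_n.
Local Notation I := (`[0, 1]%classic : set R).

Lemma punctured_loop_null_homotopic (c : R -> V) : (2 < n)%N ->
  is_loop c -> (forall s, I s -> c s != 0) -> @null_homotopic_in R V (~` [set 0]) c.
Proof.
move=> n2 [cc c01] c0.
have [q [E [cq q0 q1 cq0 qE]]] := loop_polygon cc c0.
have [v vE] := exists_avoiding_planes E n2.
(* [al] deforms the loop to the polygon during the first half of the time, [be] contracts the
   polygon to [v] during the second. *)
pose al (t : R) := Num.min 1 (2 * t); pose be (t : R) := Num.max 0 (2 * t - 1).
apply: (null_homotopic_of_free (x0 := v) (F := fun p =>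
  (1 - be p.2) *: ((1 - al p.2) *: c p.1 + al p.2 *: q p.1) + be p.2 *: v)).
- have cal : continuous al by rewrite /al; continuity.
  have cbe : continuous be by rewrite /be; continuity.
  have w2 (W : topologicalType) (f : R -> W) : continuous f ->
      {within I `*` I, continuous (fun p => f p.2)}.
    by move=> cf; apply/continuous_subspaceT/(continuous_funcomp _ cf)/continuous_snd.
  have cc1 : {within I `*` I, continuous (fun p => c p.1)}.
    apply: (continuous_within_comp (A := I) (g := fst)) => //.
      exact/continuous_subspaceT/continuous_fst.
    by move=> p [].
  have cq1 : {within I `*` I, continuous (fun p => q p.1)}.
    by apply/continuous_subspaceT/(continuous_funcomp _ cq)/continuous_fst.
  apply: continuous_addr; last first.
    apply: continuous_scaler; last by move=> ?; exact: cst_continuous.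
    exact: (w2 _ _ cbe).
  apply: continuous_scaler.
    by apply: (w2 _ (fun t => 1 - be t)); continuity.
  apply: continuous_addr; apply: continuous_scaler => //.
    by apply: (w2 _ (fun t => 1 - al t)); continuity.
  exact: (w2 _ _ cal).
- move=> s t Is; rewrite /= in_itv/= => /andP[t0 t1]; apply/eqP.
  rewrite /al /be; have [t2|t2] := leP t 2^-1.
    rewrite (@max_l _ _ 0); last lra.
    rewrite min_r; last lra.
    rewrite subr0 scale1r scale0r addr0; apply: cq0 => //; lra.
  rewrite (@max_r _ _ 0); last lra.
  rewrite min_l; last lra.
  have [e eE [a [b ->]]] := qE s Is.
  rewrite subrr scale0r scale1r add0r; apply/eqP => H.
  have k0 : 2 * t - 1 != 0 by apply: lt0r_neq0; lra.
  set k := 2 * t - 1 in k0 H.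
  (* Solving (1 - k) q + k v = 0 for v would place it in the plane of the edge [e]. *)
  have /eqP := vE e eE (- (k^-1 * (1 - k) * a)) (- (k^-1 * (1 - k) * b)).
  apply; apply: (scalerI k0).
  move: H => /eqP; rewrite addrC addr_eq0 => /eqP ->.
  rewrite !scalerDr !scalerA opprD -(scaleNr _ e.1) -(scaleNr _ e.2).
  by congr (_ *: _ + _ *: _); field.
- move=> s Is /=; rewrite /al /be mulr0 min_r// max_l; last lra.
  by rewrite subr0 !scale1r !scale0r !addr0.
- move=> s Is /=; rewrite /al /be mulr1 max_r; last lra.
  have -> : 2 - 1 = 1 :> R by ring.
  by rewrite subrr scale0r add0r scale1r.
- by move=> t It /=; rewrite c01 q0 q1 c01.
Qed.

(** Radial retraction of the punctured space onto the complement of the open ball of radius [r], for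
    the sup norm; the value at 0 is junk. *)
Definition push_out (r : R) (x : V) : V := Num.max 1 (r / `|x|) *: x.

Lemma push_out_id r x : x != 0 -> r <= `|x| -> push_out r x = x.
Proof.
move=> x0 rx; rewrite /push_out max_l ?scale1r//.
by rewrite ler_pdivrMr ?normr_gt0// mul1r.
Qed.

Lemma norm_push_out r x : x != 0 -> r <= `|push_out r x|.
Proof.
move=> x0; rewrite /push_out normrZ ger0_norm ?le_max ?ler01//.
rewrite -ler_pdivrMr ?normr_gt0//.
by rewrite le_max lexx orbT.
Qed.

Lemma continuous_push_out r x : x != 0 -> {for x, continuous (push_out r)}.
Proof.
move=> x0; apply: continuousZ; last exact: cvg_id.
apply: (continuous_max (f := cst 1) (g := fun x => r / `|x|)).
  exact: cst_continuous.
apply: continuousM; first exact: cst_continuous.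
apply: continuousV; first by rewrite normr_eq0.
exact: norm_continuous.
Qed.

Lemma segment_avoids0 (z v : V) t : z != 0 -> (forall a, v != a *: z) ->
  (1 - t) *: z + t *: v != 0.
Proof.
move=> z0 vz; have [->|t0] := eqVneq t 0.
  by rewrite subr0 scale1r scale0r addr0.
apply: contra (vz (- (t^-1 * (1 - t)))).
rewrite addrC addr_eq0 => /eqP H; apply/eqP; apply: (scalerI t0).
by rewrite H scalerA -scaleNr; congr (_ *: _); field.
Qed.

(** Two points are joined through a vector [v] outside their span: the segments to [v] miss 0 and
    are then pushed outwards. *)
Lemma exterior_connected r : (2 < n)%N -> 0 <= r -> connected [set x : V | r < `|x|].
Proof.
move=> n2 r0.
have [[x0 rx0]|E0] := pselect (exists x : V, r < `|x|); last first.
  rewrite (_ : [set x : V | _] = set0); first exact: connected0.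
  by apply/seteqP; split=> // x rx; apply: E0; exists x.
have nz (x : V) : r < `|x| -> x != 0.
  by move=> rx; rewrite -normr_gt0 (le_lt_trans r0).
have join y : r < `|y| -> exists B : set V,
    [/\ connected B, B `<=` [set x : V | r < `|x|], B x0 & B y].
  move=> ry; have [v vE] := exists_avoiding_planes [:: (x0, y)] n2.
  have {}vE a b : v != a *: x0 + b *: y by apply: (vE (x0, y)); rewrite mem_head.
  (* This radius exceeds [r], so pushed arcs stay in the exterior, yet is small enough for
     [push_out] to fix both endpoints. *)
  pose r' := Num.min `|x0| `|y|.
  pose g z t := push_out r' ((1 - t) *: z + t *: v).
  have arc z : r < `|z| -> r' <= `|z| -> (forall a, v != a *: z) ->
      [/\ connected (g z @` I), g z @` I `<=` [set x : V | r < `|x|],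
          (g z @` I) z & (g z @` I) (push_out r' v)].
    move=> rz r'z vz; split.
    - apply: connected_continuous_connected; first exact: segment_connected.
      apply: continuous_subspaceT => t.
      have cseg : continuous (fun t : R => (1 - t) *: z + t *: v) by continuity.
      have z0 := segment_avoids0 t (nz _ rz) vz.
      exact: continuous_comp (cseg t) (@continuous_push_out r' _ z0).
    - move=> _ [t _ <-] /=; apply: lt_le_trans (norm_push_out _ _).
        by rewrite lt_min rx0.
      exact/segment_avoids0/vz/nz.
    - exists 0; first by rewrite /= in_itv/= lexx ler01.
      by rewrite /g subr0 scale1r scale0r addr0 push_out_id// nz.
    - exists 1; first by rewrite /= in_itv/= lexx ler01.
      by rewrite /g subrr scale1r scale0r add0r.
  have [||a|cx sx xx xv] := arc x0 => //; first by rewrite ge_min lexx.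
    by have := vE a 0; rewrite scale0r addr0.
  have [||a|cy sy yy yv] := arc y => //; first by rewrite ge_min lexx orbT.
    by have := vE 0 a; rewrite scale0r add0r.
  exists (g x0 @` I `|` g y @` I); split.
  - by apply: connectedU => //; exists (push_out r' v).
  - by move=> z [/sx|/sy].
  - by left.
  - by right.
pose P (B : set V) := [/\ connected B, B `<=` [set x : V | r < `|x|] & B x0].
rewrite (_ : [set x : V | _] = \bigcup_(B in P) B).
  apply: bigcup_connected; last by move=> B [].
  by exists x0 => B [].
apply/seteqP; split=> [y /join[B [cB Bs Bx By]]|y [B [_ Bs _] /Bs]//].
by exists B.
Qed.

End PuncturedSpace.

(** * Exteriors of compact sets and ends *)

Section SimplyConnectedAtInfinity.
Variables (R : realType).

(* Stronger than simple connectivity at infinity, and free of ends. *)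
Definition exterior_simply_connected (X : topologicalType) : Prop :=
  forall C : set X, compact C -> exists D : set X,
    [/\ compact D, C `<=` D, ~` D !=set0, connected (~` D) &
      forall c : R -> X, is_loop c ->
        (forall s, `[0, 1]%classic s -> ~ D (c s)) -> null_homotopic_in (~` C) c].

Lemma exterior_simply_connected_space n :
  (2 < n)%N -> exterior_simply_connected 'rV[R]_n.
Proof.
move=> n2 C cC.
(* The bound is strict, so that points pushed onto the sphere of radius [r] still miss [C]. *)
have /ex_strict_bound_gt0[r r0 Cr] := compact_bounded cC.
have DC : ~` [set x : 'rV[R]_n | `|x| <= r] = [set x : 'rV[R]_n | r < `|x|].
  by apply/seteqP; split=> x /=; rewrite ltNge => /negP.
exists [set x : 'rV[R]_n | `|x| <= r]; split.
- apply: bounded_closed_compact.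
    exists r; split; first exact: num_real.
    by move=> M rM x /= xr; apply: le_trans xr (ltW rM).
  have /continuous_closedP/(_ [set y | y <= r]) := @norm_continuous _ 'rV[R]_n.
  by apply; exact: closed_le.
- by move=> x /Cr /ltW.
- rewrite DC; pose e : 'rV[R]_n := const_mx 1.
  have e0 : e != 0.
    apply/eqP => /rowP/(_ (Ordinal (ltn_trans (isT : (0 < 2)%N) n2))).
    by rewrite !mxE => /eqP; rewrite oner_eq0.
  exists (((r + 1) / `|e|) *: e) => /=.
  rewrite normrZ normrM normfV normr_id divfK ?normr_eq0// ger0_norm; lra.
- by rewrite DC; apply: exterior_connected => //; exact: ltW.
- move=> c lc cD.
  have {}cD s : `[0, 1]%classic s -> r < `|c s|.
    by move=> /cD /negP; rewrite -ltNge.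
  have c0 s : `[0, 1]%classic s -> c s != 0.
    by move=> /cD cs; rewrite -normr_gt0 (lt_trans r0).
  have [H [cH H0 Hs Ht]] := punctured_loop_null_homotopic n2 lc c0.
  have I0 : `[0, 1]%classic (0 : R) by rewrite /= in_itv/= lexx ler01.
  have rc s : `[0, 1]%classic s -> push_out r (c s) = c s.
    by move=> Is; rewrite push_out_id ?c0// ltW// cD.
  exists (push_out r \o H); split.
  + apply: within_continuous_comp cH => y; rewrite inE => -[[s t] [/= Is It] <-].
    by apply: continuous_push_out; apply/eqP; exact: H0.
  + move=> s t Is It /= /Cr; apply/negP; rewrite -leNgt norm_push_out//.
    by apply/eqP; exact: H0.
  + by move=> s Is /=; have [-> ->] := Hs s Is; rewrite !rc.
  + by move=> t It /=; have [-> ->] := Ht t It; rewrite !rc.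
Qed.

Lemma homeomorphic_exterior_simply_connected (X Y : topologicalType) :
  homeomorphic X Y -> exterior_simply_connected Y -> exterior_simply_connected X.
Proof.
move=> [f [f' [cf cf' fK f'K]]] YP C cC.
have [|D [cD CD [y Dy] DC loopD]] := YP (f @` C).
  by apply: continuous_compact => //; exact: continuous_subspaceT.
have DE : ~` (f' @` D) = f' @` (~` D).
  apply/seteqP; split=> [x xD|_ [z Dz <-] [z' Dz' /(can_inj f'K) zz']].
    by exists (f x) => // Dfx; apply: xD; exists (f x).
  by apply: Dz; rewrite -zz'.
exists (f' @` D); split.
- by apply: continuous_compact => //; exact: continuous_subspaceT.
- by move=> x Cx; exists (f x) => //; apply: CD; exists x.
- by rewrite DE; exists (f' y); exists y.
- rewrite DE; apply: connected_continuous_connected => //.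
  exact: continuous_subspaceT.
- move=> c [cc c01] cD'.
  have lfc : is_loop (f \o c).
    split; last by rewrite /= c01.
    by apply: within_continuous_comp cc => ? _; exact: cf.
  have [|H [cH HC Hs Ht]] := loopD _ lfc.
    by move=> s Is Dfc; apply: (cD' s Is); exists (f (c s)).
  exists (f' \o H); split.
  + by apply: within_continuous_comp cH => ? _; exact: cf'.
  + by move=> s t Is It /= CH; apply: (HC s t Is It); exists (f' (H (s, t))).
  + by move=> s /Hs[/= -> ->]; rewrite !fK.
  + by move=> t /Ht[/= -> ->]; rewrite !fK.
Qed.

(** The connected complement of [D C] lies in one component of the complement of [C]. These
    components form an end, and no other end is possible. *)
Lemma exterior_simply_connected_at_infinity (X : topologicalType) :
  exterior_simply_connected X -> simply_connected_at_infinity R X.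
Proof.
move=> XP; split; last first.
  by move=> C /XP[D [cD CD _ _ loopD]]; exists D.
have [D HD] : exists D : set X -> set X, forall C, compact C ->
    [/\ compact (D C), C `<=` D C, ~` D C !=set0 & connected (~` D C)].
  have /choice[D HD] : forall C, exists D : set X, compact C ->
      [/\ compact D, C `<=` D, ~` D !=set0 & connected (~` D)].
    move=> C; have [/XP[D [? ? ? ? _]]|nC] := pselect (compact C); last by exists set0.
    by exists D.
  by exists D.
have [p Hp] : exists p : set X -> X, forall C, compact C -> ~ D C (p C).
  (* The case of the empty set shows that [X] has a point, which fills [p] at noncompact sets. *)
  have [_ _ [q _] _] := HD set0 compact0.
  have /choice[p Hp] : forall C, exists x, compact C -> ~ D C x.
    move=> C; have [/HD[_ _ [x Dx] _]|nC] := pselect (compact C); last by exists q.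
    by exists x.
  by exists p.
pose e C := connected_component (~` C) (p C).
have eE C z : compact C -> ~ D C z -> e C = connected_component (~` C) z.
  move=> cC Dz; have [_ CD _ cD] := HD C cC.
  apply: same_connected_component; exists (~` D C) => //; split=> //.
    exact: Hp.
  by apply: subsetC.
exists e.
  split=> [C cC|C C' cC cC' CC'].
    exists (p C) => // Cp; have [_ CD _ _] := HD C cC.
    by apply: Hp cC _; exact: CD.
  have [cD _ _ _] := HD C cC; have [cD' _ _ _] := HD C' cC'.
  (* A point outside both [D C] and [D C'] represents both components, which makes them
     comparable. *)
  have [_ DE [z Ez] _] := HD _ (compactU cD cD').
  rewrite (eE C z)// ?(eE C' z)//.
  - move=> y [B [Bz BC' cB] By]; exists B => //; split=> //.
    by apply: subset_trans BC' _; exact: subsetC.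
  - by move=> Dz; apply: Ez; apply: DE; right.
  - by move=> Dz; apply: Ez; apply: DE; left.
move=> e' [e'C e'S] C cC; have [cD CD _ _] := HD C cC.
(* The component chosen by [e'] at [D C] contains a point outside [D C], and monotonicity forces the
   choice at [C]. *)
have [y Dy e'D] := e'C _ cD.
rewrite (eE C y)//; have [x Cx e'E] := e'C _ cC; rewrite e'E.
apply: same_connected_component; rewrite -e'E; apply: (e'S C (D C)) => //.
by rewrite e'D; exact: connected_component_refl.
Qed.

End SimplyConnectedAtInfinity.

(** * Hausdorff dimension of sets with interior *)

Section HausdorffDimension.
Variable R : realType.

Lemma lebesgue_measure_segment (a b : R) : a <= b ->
  lebesgue_measure `[a, b]%classic = (b - a)%:E.
Proof.
rewrite lebesgue_measure_itv /= lte_fin le_eqVlt => /predU1P[->|->//].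
by rewrite ltxx subrr.
Qed.

Lemma diameter_ge0 m (A : set 'rV[R]_m) : (0 <= diameter A)%E.
Proof. by apply: ereal_sup_ubound; left. Qed.

Lemma dist_coord_le m (x y : 'rV[R]_m) i : `|x 0 i - y 0 i| <= euclidean_dist x y.
Proof.
rewrite -sqrtr_sqr ler_wsqrtr// (bigD1 i) //= lerDl.
by apply: sumr_ge0 => j _; exact: sqr_ge0.
Qed.

Lemma diameter_coord m (A : set 'rV[R]_m) i x y : A x -> A y ->
  ((`|x 0 i - y 0 i|)%:E <= diameter A)%E.
Proof.
move=> Ax Ay; apply: (@le_trans _ _ (euclidean_dist x y)%:E).
  by rewrite lee_fin dist_coord_le.
by apply: ereal_sup_ubound; right; exists x => //; exists y.
Qed.

Local Notation leb := (@lebesgue_measure R).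
Local Notation area := (leb \x leb)%E.

Lemma area_rectangle (a b c d : R) : a <= b -> c <= d ->
  area (`[a, b]%classic `*` `[c, d]%classic) = ((b - a) * (d - c))%:E.
Proof.
move=> ab cd; rewrite EFinM -!lebesgue_measure_segment//.
by apply: product_measure1E; exact: measurable_itv.
Qed.

(** A set of diameter d projects into the square of side 2 d around the image of any of its points;
    the bound by 1 makes d finite. *)
Lemma projection_box m (A : set 'rV[R]_m) i j : (diameter A <= 1)%E ->
  exists B : set (R * R), [/\ measurable B,
    forall x, A x -> B (x 0 i, x 0 j) &
    (area B <= 4%:E * diameter A `^ 2)%E].
Proof.
move=> A1.
have [[z Az]|A0] := pselect (A !=set0); last first.
  exists set0; split => //; first by move=> x Ax; apply: A0; exists x.
  by rewrite measure0 mule_ge0// poweR_ge0.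
have fA : diameter A = (fine (diameter A))%:E.
  rewrite fineK// ge0_fin_numE ?diameter_ge0//.
  by rewrite (le_lt_trans A1)// ltry.
set d := fine (diameter A) in fA.
have d0 : 0 <= d by rewrite -lee_fin -fA diameter_ge0.
exists (`[z 0 i - d, z 0 i + d]%classic `*` `[z 0 j - d, z 0 j + d]%classic).
split.
- by apply: measurableX; exact: measurable_itv.
- move=> x Ax; split; rewrite /= in_itv/= -ler_distlC -lee_fin -fA;
    exact: diameter_coord.
- rewrite area_rectangle; [|lra|lra].
  rewrite fA poweR_EFin -!EFinM lee_fin powR_mulrn//; nra.
Qed.

(** Some s < 2 has null s-dimensional measure. For covers at scale 1, exponent 2 gives a sum no
    larger than exponent s. *)
Lemma small_cover m (A : set 'rV[R]_m) (e : R) : 0 < e ->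
  (hausdorff_dim A < 2%:E)%E -> exists U : nat -> set 'rV[R]_m,
  [/\ A `<=` \bigcup_k U k, forall k, (diameter (U k) <= 1)%E &
    (\sum_(0 <= k <oo) (diameter (U k) `^ 2) < e%:E)%E].
Proof.
move=> e0 /ereal_inf_lt[_ [s [s0 Hs] <-]]; rewrite lte_fin => s2.
have : (hausdorff_premeasure s 1 A < e%:E)%E.
  apply: (@le_lt_trans _ _ 0%E); last by rewrite lte_fin.
  by rewrite -Hs; apply: ereal_sup_ubound; exists 1 => //=; exact: ltr01.
move=> /ereal_inf_lt[_ [U [AU U1] <-]] Ue; exists U; split => //.
apply: le_lt_trans Ue; apply: lee_nneseries => k _; first by rewrite poweR_ge0.
have d0 := diameter_ge0 (U k).
have fd : diameter (U k) \is a fin_num.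
  by rewrite ge0_fin_numE// (le_lt_trans (U1 k))// ltry.
move: d0 (U1 k); rewrite -(fineK fd) lee_fin => d0; rewrite lee_fin => d1.
(* Diameter 0 is separate: both powers vanish because the exponents are nonzero. *)
rewrite !poweR_EFin lee_fin; move: d0; rewrite le_eqVlt => /predU1P[<-|d0].
  by rewrite powR0 ?pnatr_eq0// powR0 ?gt_eqF//.
by apply: ger_powR; [rewrite d0|exact: ltW].
Qed.

(** Otherwise a cover with sum of squared diameters below r^2 / 4 would project to boxes of total
    area below r^2 that cover a square of side [r]. *)
Lemma hausdorff_dim_ge2 m (A : set 'rV[R]_m) i j (a b r : R) : 0 < r ->
  (forall u v, a <= u <= a + r -> b <= v <= b + r ->
    exists x, [/\ A x, x 0 i = u & x 0 j = v]) ->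
  (2%:E <= hausdorff_dim A)%E.
Proof.
move=> r0 sq; rewrite leNgt; apply/negP => /small_cover.
move=> /(_ (r ^+ 2 / 4)); rewrite divr_gt0 ?exprn_gt0// => /(_ isT)[U [AU U1 Ur]].
have /choice[B HB] := fun k => projection_box i j (U1 k).
pose Q : set (R * R) := `[a, a + r]%classic `*` `[b, b + r]%classic.
have QB : Q `<=` \bigcup_k B k.
  move=> [u v] [/= Qu Qv]; have [||x [Ax xi xj]] := sq u v.
  - by move: Qu; rewrite in_itv.
  - by move: Qv; rewrite in_itv.
  have [k _ Ux] := AU x Ax; exists k => //; have [_ + _] := HB k.
  by move=> /(_ x Ux); rewrite xi xj.
have mQ : measurable Q by apply: measurableX; exact: measurable_itv.
have : (area Q <= \sum_(0 <= k <oo) area (B k))%E.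
  by apply: measure_sigma_subadditive => // k; have [] := HB k.
apply/negP; rewrite -ltNge.
apply: (@le_lt_trans _ _ (\sum_(0 <= k <oo) (4%:E * diameter (U k) `^ 2))%E).
  by apply: lee_nneseries => k _; [by []|have [] := HB k].
rewrite nneseriesZl; last by move=> k _; exact: poweR_ge0.
rewrite area_rectangle; [|lra|lra].
have -> : ((a + r - a) * (b + r - b))%:E = (4%:E * (r ^+ 2 / 4)%:E)%E.
  by rewrite -EFinM; congr EFin; field.
by rewrite lte_pmul2l.
Qed.

End HausdorffDimension.

(* Near p, the coordinates i and j are free parameters and the coordinate k is
   adjusted to stay on the sphere. *)
Lemma low_dim_interior (R : realType) n (K : set (sphere R n)) :
  (2 <= n)%N -> (hausdorff_dim (@sphere_val R n @` K) < 2%:E)%E -> K° = set0.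
Proof.
move=> n2; rewrite ltNge => /negP dimK; apply/seteqP; split => // p Kp; apply: dimK.
have [k pk] : exists k, sphere_val p 0 k != 0.
  apply: contrapT => /forallNP p0.
  have : \sum_i sphere_val p 0 i ^+ 2 = 1 by exact: (set_valP p).
  rewrite big1 => [/eqP|i _]; first by rewrite eq_sym oner_eq0.
  by have /negP/negPn/eqP -> := p0 i; rewrite expr0n.
have [i [j [ik jk ij]]] : exists i j, [/\ i != k, j != k & i != j].
  case: (n) n2 k {pk} => [|[|m]]// _ k.
  exists (fintype.lift k ord0), (fintype.lift k ord_max).
  by rewrite !(eq_sym _ k) !neq_lift (inj_eq lift_inj).
pose P := sphere_val p; rewrite -/P in pk.
(* The square of the factor that must rescale coordinate k to keep the norm 1; it equals 1 at [p],
   hence stays positive nearby. *)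
pose d (u v : R) :=
  1 + (P 0 i ^+ 2 + P 0 j ^+ 2 - u ^+ 2 - v ^+ 2) / P 0 k ^+ 2.
pose Q (u v : R) : 'rV[R]_n.+1 := \row_l
  (if l == i then u else if l == j then v else if l == k then P 0 k * Num.sqrt (d u v)
   else P 0 l).
have P1 : \sum_l P 0 l ^+ 2 = 1 by exact: (set_valP p).
have Q1 u v : 0 <= d u v -> unit_sphere (Q u v).
  move=> d0; rewrite /unit_sphere /= -P1.
  have split3 (f : 'I_n.+1 -> R) : \sum_l f l =
      f i + (f j + (f k + \sum_(l | (l != i) && (l != j) && (l != k)) f l)).
    by rewrite (bigD1 i)//= (bigD1 j) 1?eq_sym//= (bigD1 k)//= !(eq_sym k) ik jk.
  rewrite !split3 !mxE !eqxx (eq_sym j) (negbTE ij) !(eq_sym k).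
  rewrite (negbTE ik) (negbTE jk) exprMn sqr_sqrtr// /d.
  rewrite (eq_bigr (fun l => P 0 l ^+ 2)); first by field.
  by move=> l /andP[/andP[/negbTE li /negbTE lj] /negbTE lk]; rewrite mxE li lj lk.
have dp : d (P 0 i) (P 0 j) = 1 by rewrite /d; field.
have Qp : Q (P 0 i) (P 0 j) = P.
  apply/rowP => l; rewrite mxE; case: eqVneq => [->//|li].
  case: eqVneq => [->//|lj]; case: eqVneq => [->|//].
  by rewrite dp sqrtr1 mulr1.
have cd : continuous (fun w : R * R => d w.1 w.2).
  by rewrite /d; under eq_fun do rewrite !(expr2 _.1) !(expr2 _.2); continuity.
have cQ : continuous (fun w : R * R => Q w.1 w.2).
  suff cQl l : continuous (fun w : R * R => Q w.1 w.2 0 l).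
    by move=> w; apply: continuous_at_row => l; exact: cQl.
  under eq_fun do rewrite mxE.
  case: eqVneq => _; first exact: continuous_fst.
  case: eqVneq => _; first exact: continuous_snd.
  case: eqVneq => _; last by move=> ?; exact: cst_continuous.
  apply: continuous_mulr; first by move=> ?; exact: cst_continuous.
  exact: continuous_funcomp cd (@sqrt_continuous R).
move: Kp => [_ [/= [V oV <-] /= Vp VK]].
pose W := (fun w : R * R => Q w.1 w.2) @^-1` V `&`
  (fun w : R * R => d w.1 w.2) @^-1` [set y | 0 < y].
have oW : open W.
  apply: openI.
    by move/continuousP: cQ; exact.
  by move/continuousP: cd; apply; exact: open_gt.
have Ww : W (P 0 i, P 0 j).
  split=> /=; first by rewrite Qp.
  by rewrite dp ltr01.
have : nbhs (P 0 i, P 0 j) W by apply: open_nbhs_nbhs.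
move=> /nbhs_ballP[e /= e0 eW].
apply: (hausdorff_dim_ge2 (i := i) (j := j) (a := P 0 i) (b := P 0 j) (r := e / 2)).
  by rewrite divr_gt0.
move=> u v uP vP.
have [/= VQ /ltW /Q1 hQ] : W (u, v).
  apply: eW; split; rewrite /= /ball /= ler0_norm; lra.
exists (Q u v); split.
- exists (exist _ (Q u v) (mem_set hQ)) => //; exact: VK.
- by rewrite mxE eqxx.
- by rewrite mxE eq_sym (negbTE ij) eqxx.
Qed.

(** * The developing map *)

Lemma near_eq_differentiable (K : numFieldType) (V W : normedModType K)
    (f g : V -> W) (x : V) :
  {near x, f =1 g} -> differentiable f x -> differentiable g x.
Proof.
move=> fg df; have fgx : f x = g x := nbhs_singleton fg.
have dE : g \o shift x = cst (g x) + 'd f x +o_ 0 id.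
  apply/eqaddoP => e e0.
  have /eqaddoP/(_ e e0) := diff_locally df.
  have : \forall h \near 0, f (h + x) = g (h + x).
    have fgy : \forall y \near x, f y = g y by exact: fg.
    by move: fgy; rewrite (near_shift 0) subr0.
  move=> fg0; apply: filterS2 fg0 => h.
  by rewrite /= !fctE /= fgx => ->.
have cdf : continuous ('d f x) by exact: diff_continuous.
have dg := diff_unique cdf dE.
by apply/diff_locallyP; rewrite dg.
Qed.

(** Since [U] is open, the functions agree near each of its points, so their partial derivatives
    agree on [U] and induction applies. *)
Lemma Ck_on_congr (R : realType) m (V : normedModType R) k (U : set 'rV[R]_m)
    (f g : 'rV[R]_m -> V) :
  open U -> (forall x, U x -> f x = g x) -> Ck_on k U f -> Ck_on k U g.
Proof.
move=> oU.
have near_eq (f1 f2 : 'rV[R]_m -> V) x : (forall x, U x -> f1 x = f2 x) -> U x ->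
    \forall y \near x, f1 y = f2 y.
  move=> f12 Ux; have xU : nbhs x U by apply: open_nbhs_nbhs; split.
  by apply: filterS xU => y Uy; exact: f12.
elim: k f g => [|k IHk] f g fg /=.
  move=> cf x Ux; have fgx := near_eq _ _ _ fg Ux.
  rewrite /prop_for /continuous_at -fg//.
  by apply: cvg_trans (cf x Ux); exact: (@near_eq_cvg _ _ (nbhs x) _ _ _ fgx).
move=> [df Df]; split=> [x Ux|i].
  by apply: near_eq_differentiable (df x Ux); exact: near_eq.
apply: IHk (Df i) => x Ux; apply: near_eq_derive; exact: near_eq.
Qed.

(* [local_expr] chooses a preimage, so it is only determined by the chart when
   the latter is injective on its domain. *)
Definition chart_injective (R : realType) (n : nat) (X : charted R n)
    (i : Defs.index X) : Prop :=
  forall x x', chart_dom i x -> chart_dom i x' -> chart i x = chart i x' -> x = x'.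

Lemma local_expr_chart (R : realType) (n : nat) (X : charted R n) (V : zmodType)
    (i : Defs.index X) (f : X -> V) x :
  chart_injective i -> chart_dom i x -> local_expr i f (chart i x) = f x.
Proof.
move=> inj xi; rewrite /local_expr; case: pselect => [h|[]]; last by exists x.
by case: (cid h) => y [yi yx] /=; rewrite (inj y x).
Qed.

Lemma sphere_chart_injective (R : realType) n (b : bool) :
  @chart_injective R n (sphere R n) b.
Proof.
move=> x x'; set s : R := (-1) ^+ b.
have s2 : s * s = 1 by rewrite -expr2 sqrr_sign.
(* The height of [z] towards the projection pole; [1 - w z] vanishes only at the pole. *)
pose w (z : sphere R n) := s * sphere_val z 0 ord0.
have w1 z : sphere_val z 0 0 <> s -> 1 - w z != 0.
  move=> zs; apply/eqP => /subr0_eq w1; apply: zs.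
  by rewrite -[RHS]mulr1 w1 /w mulrA s2 mul1r.
have sumE (z : sphere R n) :
    \sum_k sphere_val z 0 (fintype.lift ord0 k) ^+ 2 = 1 - w z ^+ 2.
  have : \sum_k sphere_val z 0 k ^+ 2 = 1 by exact: (set_valP z).
  rewrite big_ord_recl /w exprMn (expr2 s) s2 mul1r => <-.
  by rewrite addrAC subrr add0r.
move=> /w1 xd /w1 xd' /rowP xx'.
have coord k : sphere_val x 0 (fintype.lift ord0 k) / (1 - w x) =
    sphere_val x' 0 (fintype.lift ord0 k) / (1 - w x').
  by have := xx' k; rewrite !mxE.
(* The squared norm of the stereographic image of z is (1 + w z) / (1 - w z). *)
have ww' : w x = w x'.
  have : \sum_k (sphere_val x 0 (fintype.lift ord0 k) / (1 - w x)) ^+ 2 =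
      \sum_k (sphere_val x' 0 (fintype.lift ord0 k) / (1 - w x')) ^+ 2.
    by apply: eq_bigr => k _; rewrite coord.
  under eq_bigr do rewrite expr_div_n.
  under [RHS]eq_bigr do rewrite expr_div_n.
  rewrite -!mulr_suml !sumE => /eqP.
  rewrite eqr_div ?expf_neq0// => /eqP H.
  (* The cross-multiplied sides differ by 2 (1 - w x) (1 - w x') (w x - w x'). *)
  apply: (mulfI (x := 2 * (1 - w x) * (1 - w x'))).
    by rewrite !mulf_neq0// pnatr_eq0.
  apply/subr0_eq; rewrite -[RHS](subrr ((1 - w x ^+ 2) * (1 - w x') ^+ 2)) {2}H.
  by ring.
apply: val_inj; apply/rowP => k; case: (unliftP ord0 k) => [l|] ->.
  by have := coord l; rewrite ww' => /(mulIf (invr_neq0 xd')).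
by have := congr1 ( *%R s) ww'; rewrite /w !mulrA s2 !mul1r.
Qed.

(** * Inclusion of an open submanifold *)

Section OpenInclusion.
Variables (R : realType) (n : nat) (X : charted R n) (U : set X).
Hypotheses (oU : open U) (sU : smooth_manifold (open_submanifold U)).
Hypothesis injX : forall i : Defs.index X, chart_injective i.
Local Notation M := (open_submanifold U).

Definition inclusion (x : M) : X := set_val x.

Lemma inclusion_range : range inclusion = U.
Proof.
apply/seteqP; split=> [_ [x _ <-]|x Ux]; first exact: set_valP.
by exists (exist _ x (mem_set Ux)).
Qed.

(** The charts of [M] are restrictions, so the inclusion and its inverse are expressed by transition
    maps of [M], which are smooth by [sU]. *)
Lemma inclusion_local_diffeo : local_diffeo inclusion.
Proof.
move=> x0; exists setT; split=> //; first exact: openT.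
have [_ _ _ chartM smM] := sU.
split.
- split=> [x _|i j]; first exact: initial_continuous.
  by rewrite setTI; exact: smM.
- by rewrite -[X in open X]/(range inclusion) inclusion_range.
pose f' (y : X) : M := if pselect (U y) is left Uy then exist _ y (mem_set Uy) else x0.
have f'K y : U y -> inclusion (f' y) = y.
  by move=> Uy; rewrite /f'; case: pselect.
have f'E x : f' (inclusion x) = x.
  by apply: val_inj; apply: f'K; exact: set_valP.
exists f'; split; last by move=> x _; exact: f'E.
rewrite -[X in smooth_map_on X]/(range inclusion) inclusion_range; split.
  move=> y Uy; apply: continuous_at_set_type.
  have yU : nbhs y U by apply: open_nbhs_nbhs; split.
  have ny : \forall z \near y, id z = set_val (f' z).
    by apply: filterS yU => z /f'K.
  rewrite /prop_for /continuous_at [X in _ --> X](f'K y Uy).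
  exact: (@near_eq_cvg _ _ (nbhs y) _ _ _ ny).
move=> i j k.
have SE : chart i @` (U `&` chart_dom i `&` f' @^-1` chart_dom j) =
    chart (i : Defs.index M) @`
      (chart_dom (i : Defs.index M) `&` chart_dom (j : Defs.index M)).
  apply/seteqP; split=> [_ [y [[Uy yi] yj] <-]|_ [x [xi xj] <-]].
    exists (f' y); last by rewrite -[in RHS](f'K y Uy).
    by split => //; rewrite -(f'K y Uy) in yi.
  exists (inclusion x) => //; split; last by rewrite /preimage /= f'E.
  by split => //; exact: set_valP.
rewrite SE.
have [oi inji conti openi] := chartM i; have [oj _ _ _] := chartM j.
(* The expressions taken in [X] and in [M] agree on the open image of the overlap, by injectivity of
   the charts. *)
apply: Ck_on_congr (smM i j k).
  by apply: openi; [exact: openI|move=> x []].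
move=> _ [x [xi xj] <-].
rewrite local_expr_chart//.
rewrite (_ : chart (i : Defs.index M) x = chart i (inclusion x))//.
by rewrite local_expr_chart//= f'E.
Qed.

End OpenInclusion.

(** * Application to the complement of [K] *)

Lemma homeomorphic_Rn_simply_connected_at_infinity (R : realType) n
    (X : topologicalType) :
  (2 < n)%N -> homeomorphic X 'rV[R]_n -> simply_connected_at_infinity R X.
Proof.
move=> n2 XRn; apply: exterior_simply_connected_at_infinity.
exact: homeomorphic_exterior_simply_connected XRn (exterior_simply_connected_space n2).
Qed.

Lemma set_type_hausdorff (X : topologicalType) (A : set X) :
  hausdorff_space X -> hausdorff_space A.
Proof.
move=> hX p q pq; apply: val_inj; apply: hX => V W pV qW.
have [z [Vz Wz]] : (set_val @^-1` V `&` set_val @^-1` W : set A) !=set0.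
  by apply: pq; [exact: (initial_continuous pV)|exact: (initial_continuous qW)].
by exists (set_val z).
Qed.

Section ConformalData.
Variables (R : realType) (n : nat) (K : set (sphere R n)) (phi : complement K -> R).
Hypothesis data : conformal_data phi.
Local Notation M := (complement K).

(** In coordinates, pulling back along the inclusion is the same as along the identity of [M]. The
    change-of-chart formula of the conformal metric, divided by its factor [a], is therefore the
    claim. *)
Lemma conformal_metric_inclusion t : 0 <= t ->
  conformal_on (conformal_metric phi t) (@round_metric R n) setT
    (@inclusion R n (sphere R n) (~` K)).
Proof.
move=> t0 x _; have [_ [_ phi0 m0] _ met] := data.
have mt : - inf_fun phi < t by rewrite (lt_le_trans _ t0)// oppr_lt0.
have [[_ _ _ compat] _ _ _] := met t mt.
pose a := (phi x + t) `^ (4 / (n%:R - 2)).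
have a0 : 0 < a by apply: powR_gt0; exact: ltr_wpDr.
exists a^-1; first by rewrite invr_gt0.
have gE (i : Defs.index M) : chart_dom i x ->
    conformal_metric phi t i (chart i x) = a *: @round_metric R n i (chart i x).
  move=> xi; rewrite /conformal_metric local_expr_chart//.
  move=> y y' yi y'i yy'; apply: val_inj.
  exact: (sphere_chart_injective yi y'i yy').
move=> i j xi xj; have := compat i j x xi xj.
rewrite gE// scalerA mulVf ?gt_eqF// scale1r.
move=> H; apply: (scalerI (lt0r_neq0 a0)); rewrite H /pullback.
by rewrite (gE j)//= -!scalemxAr -!scalemxAl.
Qed.

End ConformalData.

Theorem corollary6p20 (R : realType) (n : nat) (n_ge4 : (4 <= n)%N) :
  (forall (K : set (sphere R n)) (phi : complement K -> R),
    conformal_data phi ->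
    let M := complement K in
    let iota : M -> sphere R n := fun x => set_val x in
    let Lambda := ~` range iota in
    [/\ [/\ connected [set: M], smooth_manifold M, open_manifold M &
            simply_connected R M],
        forall i : nat, reduced_homology_trivial R M i,
        forall t : R, 0 <= t ->
          complete_lcf_nonneg (conformal_metric phi t) /\
          developing_map (conformal_metric phi t) iota,
        [/\ Lambda = K, boundary (range iota) = K &
            nondegenerate_continuum Lambda] &
        ~ homeomorphic M 'rV[R]_n]) /\
  ((exists (K : set (sphere R n)) (phi : complement K -> R),
      conformal_data phi) ->
    [/\ exists (X : charted R n) (g : metric_data X),
          [/\ open_manifold X, simply_connected R X, complete_lcf_nonneg g &
              ~ homeomorphic X 'rV[R]_n],
        ~ (forall (X : charted R n) (g : metric_data X),
             open_manifold X -> simply_connected R X ->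
             complete_lcf_nonneg g -> homeomorphic X 'rV[R]_n),
        exists (X : charted R n) (g : metric_data X),
          [/\ connected [set: X] /\ open_manifold X, simply_connected R X,
              reduced_homology_trivial R X n.-1, complete_lcf_nonneg g &
              ~ homeomorphic X 'rV[R]_n] &
        ~ (forall (X : charted R n) (g : metric_data X),
             connected [set: X] -> open_manifold X -> simply_connected R X ->
             reduced_homology_trivial R X n.-1 ->
             complete_lcf_nonneg g -> homeomorphic X 'rV[R]_n)]).
Proof.
have n2 : (2 < n)%N by exact: leq_trans n_ge4.
have main (K : set (sphere R n)) (phi : complement K -> R) : conformal_data phi ->
    let M := complement K in
    let iota : M -> sphere R n := fun x => set_val x in
    let Lambda := ~` range iota in
    [/\ [/\ connected [set: M], smooth_manifold M, open_manifold M &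
            simply_connected R M],
        forall i : nat, reduced_homology_trivial R M i,
        forall t : R, 0 <= t ->
          complete_lcf_nonneg (conformal_metric phi t) /\
          developing_map (conformal_metric phi t) iota,
        [/\ Lambda = K, boundary (range iota) = K &
            nondegenerate_continuum Lambda] &
        ~ homeomorphic M 'rV[R]_n].
  move=> data M iota Lambda.
  have [[contK dimK] [_ phi0 m0] [cM oM nsci] met] := data.
  have [sM _] := oM; have [_ cK _ _] := contK.
  have clK : closed K.
    by apply: compact_closed => //; apply: set_type_hausdorff; exact: norm_hausdorff.
  have oCK : open (~` K) by exact: closed_openC.
  have rangeE : range iota = ~` K by exact: inclusion_range.
  have LK : Lambda = K by rewrite /Lambda rangeE setCK.
  split.
  - split=> //; last exact: contractible_simply_connected.
    exact: path_connected_connected (contractible_path_connected cM).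
  - by move=> i; exact: contractible_acyclic.
  - move=> t t0; have mt : - inf_fun phi < t by rewrite (lt_le_trans _ t0)// oppr_lt0.
    have [rg cg lg sg] := met t mt.
    split; first split=> // i x xi.
      rewrite sg// mulr_ge0 ?powR_ge0// !mulr_ge0//.
      by rewrite subr_ge0 ler1n (leq_trans _ n2).
    split; last exact: conformal_metric_inclusion.
    apply: inclusion_local_diffeo => //.
    by move=> i; exact: sphere_chart_injective.
  - split=> //; last by rewrite LK.
    (* The closure of the complement omits exactly the interior of [K], which is empty as 1 < 2. *)
    rewrite rangeE /boundary closure_setC low_dim_interior//; last 2 first.
    + exact: ltnW.
    + by rewrite dimK lte_fin ltr1n.
    by rewrite setC0 (interior_id _).1// setTD setCK.
  - by move=> /(homeomorphic_Rn_simply_connected_at_infinity n2).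
split; first exact: main.
move=> [K [phi data]].
have [[conM sM oM scM] hM met _ nRn] := main K phi data.
(* The scalar-flat member t = 0 of the family witnesses both existence statements and refutes both
   implications. *)
have [g0 _] := met 0 (lexx 0).
split.
- by exists (complement K), (conformal_metric phi 0).
- by move=> H; exact: nRn (H _ _ oM scM g0).
- by exists (complement K), (conformal_metric phi 0).
- by move=> H; exact: nRn (H _ _ conM oM scM (hM _) g0).
Qed.
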